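(* There is a dense subset $\Lambda'\subset\Lambda$ such that for every $\lambda\in\Lambda'$ the map $Q_\lambda$ has a wandering disc contained in $K(Q_\lambda,B)$ which is not attracted to an attracting cycle.
   Context: Let $p$ be a prime and $\mathbb C_p$ the completion of an algebraic closure of $\mathbb Q_p$, with $|p|=1/p$. Let $\Lambda=\{\lambda\in\mathbb C_p:|\lambda-1|<1\}$, $P_\lambda(z)=\frac{\lambda}{p}z^p+\left(1-\frac{\lambda}{p}\right)z^{p+1}$, $\rho=p^{-1/(p-1)}$. Fix $\hat r\in|\mathbb C_p^*|$, $\hat r>1$, $B=\{z:|z|\le\hat r\}$; $\mathcal H(B)$ is the ring of power series $\sum a_iz^i$ convergent on $B$, normed by $\|f\|_B=\sup_i|a_i|\hat r^{\,i}$. Fix $Q\in\mathcal H(B)$ with $\|Q\|_B<\rho$ and put $Q^*_\lambda=P_\lambda+Q$. For $\lambda\in\Lambda$, $h(\lambda)$ denotes the unique fixed point of $Q^*_\lambda$ in $\{z:|z-1|\le|Q(1)|/p\}$. Let $A_\lambda(z)=z+h(\lambda)-1$ and $Q_\lambda=A_\lambda^{-1}\circ Q^*_\lambda\circ A_\lambda$, i.e. $Q_\lambda(z)=P_\lambda(z+h(\lambda)-1)+Q(z+h(\lambda)-1)+1-h(\lambda)$ for $z\in B$ (so $Q_\lambda(1)=1$). The filled Julia set is $K(Q_\lambda,B)=\{z\in B:Q_\lambda^n(z)\in B\ \forall n\ge0\}$. A closed ball $D$ is a wandering disc if $Q_\lambda^n(D)\cap Q_\lambda^m(D)\ne\emptyset$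 only when $n=m$; it is ''not attracted to an attracting cycle'' if no point of $D$ lies in an open ball contained in the basin of an attracting periodic orbit (a periodic point $z_0$ of period $k$ with $|(Q_\lambda^k)'(z_0)|<1$). *)

(* Defs.v *)
From HB Require Import structures.
From mathcomp Require Import all_boot all_order all_algebra.
From mathcomp Require Import reals.
From Stdlib Require Import ClassicalEpsilon.
Set Implicit Arguments. Unset Strict Implicit. Unset Printing Implicit Defensive.
Import Order.TTheory GRing.Theory Num.Theory.
Local Open Scope ring_scope.

(* K is a field with an absolute value abs : K -> R which is
   non-archimedean, normalised by |p| = 1/p, of characteristic 0,
   complete, algebraically closed, and in which the algebraic numbers are
   dense.  These properties characterise C_p (the completion of an algebraic
   closure of Q_p) up to isometric isomorphism. *)

Definition kconv (R : realType) (K : fieldType) (abs : K -> R)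
  (u : nat -> K) (l : K) : Prop :=
  forall e : R, 0 < e -> exists N : nat, forall n, (N <= n)%N -> abs (u n - l) < e.

Definition kcauchy (R : realType) (K : fieldType) (abs : K -> R)
  (u : nat -> K) : Prop :=
  forall e : R, 0 < e -> exists N : nat,
    forall n m, (N <= n)%N -> (N <= m)%N -> abs (u n - u m) < e.

Definition algebraic_over_Q (K : fieldType) (x : K) : Prop :=
  exists q : {poly int}, q != 0 /\ root (map_poly intr q) x.

Definition is_Cp (R : realType) (K : fieldType) (p : nat) (abs : K -> R) : Prop :=
     (forall x, 0 <= abs x)
  /\ (forall x, abs x = 0 <-> x = 0)
  /\ (forall x y, abs (x * y) = abs x * abs y)
  /\ (forall x y, abs (x + y) <= Num.max (abs x) (abs y))
  /\ abs (p%:R) = (p%:R)^-1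
  /\ (forall n : nat, (n.+1)%:R != 0 :> K)
  /\ (forall u, kcauchy abs u -> exists l, kconv abs u l)
  /\ (forall P : {poly K}, (1 < size P)%N -> exists x, root P x)
  /\ (forall x (e : R), 0 < e -> exists y, algebraic_over_Q y /\ abs (x - y) < e).

(* a : nat -> K is the coefficient sequence of sum a_i z^i.  It lies in
   H(B) iff |a_i| rhat^i -> 0. *)
Definition in_HB (R : realType) (K : fieldType) (abs : K -> R) (rhat : R)
  (a : nat -> K) : Prop :=
  forall e : R, 0 < e -> exists N : nat, forall i, (N <= i)%N -> abs (a i) * rhat ^+ i < e.

Definition ps_eval (R : realType) (K : fieldType) (abs : K -> R)
  (a : nat -> K) (z : K) : K :=
  epsilon (inhabits 0)
    (fun l => kconv abs (fun n => \sum_(i < n) a i * z ^+ i) l).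

Definition inB (R : realType) (K : fieldType) (abs : K -> R) (rhat : R) (z : K) :=
  abs z <= rhat.

Definition P_lam (K : fieldType) (p : nat) (l z : K) : K :=
  l / p%:R * z ^+ p + (1 - l / p%:R) * z ^+ p.+1.

Definition Qstar (R : realType) (K : fieldType) (p : nat) (abs : K -> R)
  (a : nat -> K) (l z : K) : K :=
  P_lam p l z + ps_eval abs a z.

(* h(l): the (unique) fixed point of Q*_l in {|z - 1| <= |Q(1)|/p} *)
Definition hfix (R : realType) (K : fieldType) (p : nat) (abs : K -> R)
  (a : nat -> K) (l : K) : K :=
  epsilon (inhabits 0)
    (fun z => abs (z - 1) <= abs (ps_eval abs a 1) / p%:R /\ Qstar p abs a l z = z).

(* Q_l = A_l^{-1} o Q*_l o A_l, A_l(z) = z + h(l) - 1 *)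
Definition Qmap (R : realType) (K : fieldType) (p : nat) (abs : K -> R)
  (a : nat -> K) (l z : K) : K :=
  Qstar p abs a l (z + hfix p abs a l - 1) + 1 - hfix p abs a l.

Definition in_filled (R : realType) (K : fieldType) (abs : K -> R) (rhat : R)
  (f : K -> K) (z : K) : Prop :=
  forall n : nat, inB abs rhat (iter n f z).

Definition cball (R : realType) (K : fieldType) (abs : K -> R) (c : K) (s : R)
  (z : K) : Prop := abs (z - c) <= s.

Definition wandering (K : fieldType) (f : K -> K) (D : K -> Prop) : Prop :=
  forall n m : nat,
    (exists z1 z2, D z1 /\ D z2 /\ iter n f z1 = iter m f z2) -> n = m.

Definition has_deriv (R : realType) (K : fieldType) (abs : K -> R)
  (g : K -> K) (z0 d : K) : Prop :=
  forall e : R, 0 < e -> exists del : R, 0 < del /\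
    forall z, 0 < abs (z - z0) < del ->
      abs ((g z - g z0) / (z - z0) - d) < e.

Definition attracting_periodic (R : realType) (K : fieldType) (abs : K -> R)
  (rhat : R) (f : K -> K) (z0 : K) (k : nat) : Prop :=
  [/\ (0 < k)%N, in_filled abs rhat f z0, iter k f z0 = z0 &
      exists d, has_deriv abs (iter k f) z0 d /\ abs d < 1].

Definition in_basin (R : realType) (K : fieldType) (abs : K -> R)
  (rhat : R) (f : K -> K) (z0 : K) (k : nat) (z : K) : Prop :=
  in_filled abs rhat f z /\
  forall e : R, 0 < e -> exists N : nat, forall n, (N <= n)%N ->
    exists j, (j < k)%N /\ abs (iter n f z - iter j f z0) < e.

Definition not_attracted (R : realType) (K : fieldType) (abs : K -> R)
  (rhat : R) (f : K -> K) (D : K -> Prop) : Prop :=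
  ~ exists z0 k, attracting_periodic abs rhat f z0 k /\
      exists x c (s : R), [/\ D x, 0 < s, abs (x - c) < s &
        forall z, abs (z - c) < s -> in_basin abs rhat f z0 k z].

(* Main.v *)
(* Write f_l = Q*_l.  On the ball of radius rho around 0 nothing escapes; for
   rho < |z| < 1 one has |f_l(z)| = p |z|^p > |z|, and f_l contracts distances
   there; near the fixed point h(l) it expands them by the factor p.  A disc
   wanders without being attracted to a cycle as soon as its orbit keeps
   coming back to |z| < 1 while passing closer and closer to h(l): each
   distance |f_l^t(z) - h(l)| is then the same for all z in the disc, and this
   sequence takes arbitrarily small positive values, so it is not eventually
   periodic.

   Such parameters l are found by successive approximation.  Suppose that, on
   the ball of radius p^-m around c, the map F_n(l) = f_l^n(x(l)) scales
   distances by p^m, hence is essentially onto the unit ball.  Choose l so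
   that F_n(l) climbs, in M steps, from the annulus to within p^-(m+2) of
   h(l).  If M is large, the dependence of F_n on l is contracted away and only
   the effect of the last step of the climb remains, which makes F_(n+M) an
   isometry in l near that parameter; after m+2 more steps near h(l) the
   hypothesis holds again with m+2 instead of m.  The same contraction keeps
   the disc around x(l) from growing.  Letting x(l) = (l - l0) / p^k starts the
   process in an arbitrarily small ball around l0. *)
Require Import Defs.
From HB Require Import structures.
From mathcomp Require Import all_boot all_order all_algebra.
From mathcomp Require Import reals ring lra.
From Stdlib Require Import ClassicalEpsilon Classical.
Import Order.TTheory GRing.Theory Num.Theory.
Local Open Scope ring_scope.

Section WanderingDiscs.
Variables (R : realType) (K : fieldType) (abs : K -> R).
Hypothesis abs_ge0 : forall x, 0 <= abs x.
Hypothesis abs_eq0 : forall x, abs x = 0 <-> x = 0.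
Hypothesis absM : {morph abs : x y / x * y}.
Hypothesis absD : forall x y, abs (x + y) <= Num.max (abs x) (abs y).

(** * Ultrametric absolute values *)

Lemma abs0 : abs 0 = 0. Proof. exact/abs_eq0. Qed.

Lemma abs_gt0 x : (0 < abs x) = (x != 0).
Proof.
rewrite lt_def abs_ge0 andbT; congr (~~ _).
by apply/eqP/eqP => /abs_eq0.
Qed.

Lemma abs1 : abs 1 = 1.
Proof.
have h : abs 1 != 0 by rewrite gt_eqF // abs_gt0 oner_neq0.
by apply: (mulfI h); rewrite -absM !mulr1.
Qed.

Lemma absX x n : abs (x ^+ n) = abs x ^+ n.
Proof. by elim: n => [|n IH]; rewrite ?expr0 ?abs1 // !exprS absM IH. Qed.

Lemma absN x : abs (- x) = abs x.
Proof.
rewrite -mulN1r absM; suff -> : abs (-1) = 1 by rewrite mul1r.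
apply/eqP; rewrite -(@pexpr_eq1 _ _ 2) //.
by rewrite -absX sqrrN expr1n abs1.
Qed.

Lemma absB x y : abs (x - y) = abs (y - x).
Proof. by rewrite -absN opprB. Qed.

Lemma absV x : abs x^-1 = (abs x)^-1.
Proof.
have [->|x0] := eqVneq x 0; first by rewrite invr0 abs0 invr0.
have h : abs x != 0 by rewrite gt_eqF // abs_gt0.
by apply: (mulfI h); rewrite -absM !mulfV // abs1.
Qed.

Lemma absf x y : abs (x / y) = abs x / abs y.
Proof. by rewrite absM absV. Qed.

Lemma abs_leD b x y : abs x <= b -> abs y <= b -> abs (x + y) <= b.
Proof. by move=> hx hy; apply: le_trans (absD x y) _; rewrite ge_max hx. Qed.

Lemma abs_ltD b x y : abs x < b -> abs y < b -> abs (x + y) < b.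
Proof. by move=> hx hy; apply: le_lt_trans (absD x y) _; rewrite gt_max hx. Qed.

Lemma abs_leB b x y : abs x <= b -> abs y <= b -> abs (x - y) <= b.
Proof. by move=> hx hy; apply: abs_leD; rewrite ?absN. Qed.

Lemma abs_ltB b x y : abs x < b -> abs y < b -> abs (x - y) < b.
Proof. by move=> hx hy; apply: abs_ltD; rewrite ?absN. Qed.

Lemma abs_leT b x y z : abs (x - y) <= b -> abs (y - z) <= b -> abs (x - z) <= b.
Proof. by move=> hx hy; rewrite -(subrK y x) -addrA; apply: abs_leD. Qed.

Lemma abs_addl x y : abs x < abs y -> abs (x + y) = abs y.
Proof.
move=> h; apply/eqP; rewrite eq_le; apply/andP; split.
  by apply: abs_leD => //; apply: ltW.
rewrite leNgt; apply/negP => h2.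
have: abs ((x + y) - x) < abs y by apply: abs_ltB.
by rewrite addrC addKr ltxx.
Qed.

Lemma abs_eqB x y : abs (x - y) < abs y -> abs x = abs y.
Proof. by move=> h; rewrite -{1}(subrK y x) abs_addl. Qed.

Lemma abs_sum (I : finType) (F : I -> K) b : 0 <= b ->
  (forall i, abs (F i) <= b) -> abs (\sum_i F i) <= b.
Proof.
move=> b0 h; apply: (big_ind (fun x => abs x <= b)) => //; first by rewrite abs0.
by move=> x y; apply: abs_leD.
Qed.

Lemma abs_nat n : abs n%:R <= 1.
Proof.
elim: n => [|n IH]; first by rewrite abs0 ler01.
by rewrite -addn1 natrD; apply: abs_leD; rewrite ?abs1.
Qed.

Lemma abs_subX n z w r : abs z <= r -> abs w <= r ->
  abs (z ^+ n.+1 - w ^+ n.+1) <= r ^+ n * abs (z - w).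
Proof.
move=> hz hw; have r0 : 0 <= r by apply: le_trans hz.
rewrite subrXX absM mulrC ler_wpM2r //.
apply: abs_sum => [|i]; first exact: exprn_ge0.
have -> : r ^+ n = r ^+ (n - i) * r ^+ i by rewrite -exprD subnK // -ltnS.
by rewrite absM !absX ler_pM ?exprn_ge0 // lerXn2r // nnegrE ?abs_ge0.
Qed.

Lemma subX_le n z w : abs z <= 1 -> abs w <= 1 ->
  abs (z ^+ n - w ^+ n) <= abs (z - w).
Proof.
case: n => [|n] hz hw; first by rewrite subrr abs0.
by have := abs_subX n z w 1 hz hw; rewrite expr1n mul1r.
Qed.

(** In the binomial expansion of [(w + e) ^+ p], with [e = z - w], the middle coefficients are
    divisible by [p] and give the second entry of the maximum; [e ^+ p] gives the first. *)
Lemma abs_subXp p z w r : prime p -> abs z <= r -> abs w <= r ->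
  abs (z ^+ p - w ^+ p) <=
    Num.max (abs (z - w) ^+ p) (abs p%:R * r ^+ p.-1 * abs (z - w)).
Proof.
case: p => [//|n] p_pr; set e := z - w => hz hw.
have r0 : 0 <= r by apply: le_trans hz.
have -> : z = w + e by rewrite /e addrC subrK.
have he : abs e <= r by apply: abs_leB.
rewrite exprDn big_ord_recl big_ord_recr /=.
rewrite subn0 expr0 mulr1 bin0 mulr1n [w ^+ _ + _]addrC addrK.
rewrite /bump /= add1n subnn expr0 mul1r binn mulr1n.
apply: le_trans (absD _ _) _; rewrite maxC ge_max le_max absX lexx /=.
rewrite le_max; apply/orP; right.
apply: abs_sum => [|i]; first by rewrite !mulr_ge0 ?exprn_ge0.
rewrite /= add1n -mulr_natr !absM !absX.
have [k ->] : exists k, 'C(n.+1, i.+1) = (k * n.+1)%N.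
  by apply/dvdnP; apply: prime_dvd_bin; rewrite //= ltnS.
rewrite natrM absM [abs e ^+ _]exprSr subSS.
have -> : r ^+ n = r ^+ (n - i) * r ^+ i by rewrite -exprD subnK // ltnW.
have h1 : abs w ^+ (n - i) <= r ^+ (n - i) by rewrite lerXn2r // nnegrE.
have h2 : abs e ^+ i <= r ^+ i by rewrite lerXn2r // nnegrE.
have h3 := abs_nat k.
set P := abs n.+1%:R.
have -> : abs w ^+ (n - i) * (abs e ^+ i * abs e) * (abs k%:R * P) =
  (abs w ^+ (n - i) * abs e ^+ i * abs k%:R) * (P * abs e) by ring.
have -> : P * (r ^+ (n - i) * r ^+ i) * abs e =
  (r ^+ (n - i) * r ^+ i * 1) * (P * abs e) by ring.
rewrite ler_wpM2r ?mulr_ge0 ?abs_ge0 //.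
by apply: ler_pM => //; rewrite ?mulr_ge0 ?exprn_ge0 //; apply: ler_pM; rewrite ?exprn_ge0.
Qed.

Lemma kconv_cst_le u l y b : 0 <= b -> kconv abs u l ->
  (exists N : nat, forall n, (N <= n)%N -> abs (u n - y) <= b) -> abs (l - y) <= b.
Proof.
move=> b0 hu [N hN]; rewrite leNgt; apply/negP => hb.
have e0 : 0 < abs (l - y) by apply: le_lt_trans hb.
have [N2 h2] := hu _ e0.
have /h2 a1 : (N2 <= maxn N N2)%N by rewrite leq_maxr.
have /hN a2 : (N <= maxn N N2)%N by rewrite leq_maxl.
have := abs_ltD (abs (l - y)) (- (u (maxn N N2) - l)) (u (maxn N N2) - y).
rewrite absN => /(_ a1 (le_lt_trans a2 hb)).
by rewrite opprB addrA subrK ltxx.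
Qed.

(** * Uniform limits of polynomials on balls *)

Hypothesis Kclosed :
  forall P : {poly K}, (1 < size P)%N -> exists x, root P x.

(** Each root [x] lies outside the ball, so [l - x] and [u - x] have the absolute value of [a - x],
    which exceeds [abs (l - u)]. Splitting off one linear factor at a time carries this to the
    product. *)
Lemma rootfree_poly_lt (T : {poly K}) a r l u : T != 0 ->
  (forall x, abs (x - a) <= r -> ~~ root T x) ->
  abs (l - a) <= r -> abs (u - a) <= r -> abs (T.[l] - T.[u]) < abs T.[u].
Proof.
move=> T0 hT hl hu; have [n hn] := ubnP (size T).
elim: n => // n IH in T T0 hT hn *.
have [h|h] := leqP (size T) 1.
  have [c eT] : exists c, T = c%:P by exists T`_0; apply: size1_polyC.
  rewrite eT !hornerC subrr abs0 abs_gt0; move: T0; rewrite eT.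
  by rewrite polyC_eq0.
have [x hx] := Kclosed T h; have /factor_theorem [U eT] := hx.
have U0 : U != 0 by apply: contraNneq T0 => U0; rewrite eT U0 mul0r.
have sU : (size U < n)%N.
  move: hn; rewrite eT size_Mmonic ?monicXsubC // size_XsubC addn2 /= ltnS.
  exact.
have hU : forall y, abs (y - a) <= r -> ~~ root U y.
  by move=> y /hT; apply: contra => rU; rewrite eT rootM rU.
have := IH U U0 hU sU.
have hxr : r < abs (a - x).
  by rewrite absB ltNge; apply/negP => /hT; rewrite hx.
have e1 : abs (l - x) = abs (a - x).
  rewrite -(abs_addl (l - a) (a - x)); last exact: le_lt_trans hxr.
  by congr abs; ring.
have e2 : abs (u - x) = abs (a - x).
  rewrite -(abs_addl (u - a) (a - x)); last exact: le_lt_trans hxr.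
  by congr abs; ring.
have hlu : abs (l - u) <= r by apply: (abs_leT _ _ a); rewrite // absB.
move=> h1; rewrite eT !hornerM !hornerXsubC absM e2.
have -> : U.[l] * (l - x) - U.[u] * (u - x) =
  (U.[l] - U.[u]) * (l - x) + U.[u] * (l - u) by ring.
have ax0 : 0 < abs (a - x) by apply: le_lt_trans hxr; apply: le_trans hlu.
apply: abs_ltD; rewrite absM.
  by rewrite e1 ltr_pM2r.
rewrite ltr_pM2l; first exact: le_lt_trans hxr.
by rewrite lt_def abs_ge0 andbT; apply/eqP=> e; move: h1; rewrite e ltNge abs_ge0.
Qed.

Lemma poly_root_in_ball (T : {poly K}) a r l u :
  abs (l - a) <= r -> abs (u - a) <= r -> abs T.[u] <= abs (T.[l] - T.[u]) ->
  exists x, abs (x - a) <= r /\ T.[x] = 0.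
Proof.
move=> hl hu h; have [->|T0] := eqVneq T 0; first by exists l; rewrite horner0.
apply: NNPP => hx.
have: abs (T.[l] - T.[u]) < abs T.[u].
  apply: (rootfree_poly_lt _ a r) => // x xa; apply/negP => /rootP xr.
  by apply: hx; exists x.
by rewrite ltNge h.
Qed.

Lemma exists_nth_root n (x : K) : exists y, y ^+ n.+1 = x.
Proof.
have [|y /rootP] := Kclosed ('X^(n.+1) - x%:P).
  by rewrite size_XnsubC.
by rewrite hornerD hornerN hornerC hornerXn => /eqP; rewrite subr_eq0 => /eqP; exists y.
Qed.

(** Substitute for analyticity on [D], stable under ring operations and uniform limits. The bound on
    [F] gives stability under products. *)
Definition poly_approx (D : K -> Prop) (F : K -> K) :=
  (exists C, forall x, D x -> abs (F x) <= C) /\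
  forall e : R, 0 < e ->
    exists T : {poly K}, forall x, D x -> abs (F x - T.[x]) <= e.

Section PolyApprox.
Variable D : K -> Prop.

Lemma poly_approx_ext F G :
  (forall x, D x -> F x = G x) -> poly_approx D F -> poly_approx D G.
Proof.
move=> h [[C hC] hF]; split; first by exists C => x dx; rewrite -h // hC.
by move=> e /hF [T hT]; exists T => x dx; rewrite -h // hT.
Qed.

Lemma poly_approx_cst c : poly_approx D (fun=> c).
Proof.
split; first by exists (abs c).
by move=> e e0; exists c%:P => x _; rewrite hornerC subrr abs0 ltW.
Qed.

Lemma poly_approx_id a r : (forall x, D x -> abs (x - a) <= r) -> poly_approx D id.
Proof.
move=> h; split.
  exists (Num.max r (abs a)) => x /h hx; rewrite -(subrK a x).
  by apply: abs_leD; rewrite le_max ?hx ?lexx ?orbT.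
by move=> e e0; exists 'X => x _; rewrite hornerX subrr abs0 ltW.
Qed.

Lemma poly_approxD F G :
  poly_approx D F -> poly_approx D G -> poly_approx D (fun x => F x + G x).
Proof.
move=> [[C hC] hF] [[C' hC'] hG]; split.
  exists (Num.max C C') => x dx.
  by apply: abs_leD; rewrite le_max ?hC ?hC' ?orbT.
move=> e e0; have [T hT] := hF e e0; have [S hS] := hG e e0.
exists (T + S) => x dx; rewrite hornerD opprD addrACA.
by apply: abs_leD; [apply: hT | apply: hS].
Qed.

Lemma poly_approxM F G :
  poly_approx D F -> poly_approx D G -> poly_approx D (fun x => F x * G x).
Proof.
move=> [[C hC] hF] [[C' hC'] hG].
pose B := Num.max 1 (Num.max C C').
have B1 : 1 <= B by rewrite le_max lexx.
have B0 : 0 < B by apply: lt_le_trans B1.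
have FB x : D x -> abs (F x) <= B by move=> /hC h; rewrite !le_max h orbT.
have GB x : D x -> abs (G x) <= B by move=> /hC' h; rewrite !le_max h !orbT.
split; first by exists (B * B) => x dx; rewrite absM ler_pM ?FB ?GB.
move=> e e0; pose d := Num.min 1 (e / B).
have d0 : 0 < d by rewrite lt_min ltr01 divr_gt0.
have [T hT] := hF d d0; have [S hS] := hG d d0.
have dB : d * B <= e by rewrite -ler_pdivlMr // ge_min lexx orbT.
exists (T * S) => x dx; rewrite hornerM.
have SB : abs S.[x] <= B.
  rewrite -(subrK (G x) S.[x]); apply: abs_leD; last exact: GB.
  by rewrite absB; apply: le_trans (hS x dx) _; rewrite ge_min B1.
have -> : F x * G x - T.[x] * S.[x] = F x * (G x - S.[x]) + (F x - T.[x]) * S.[x].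
  by ring.
apply: abs_leD; rewrite absM; apply: le_trans dB.
  by rewrite mulrC ler_pM // ?hS ?FB.
by rewrite ler_pM // hT.
Qed.

Lemma poly_approxX F n : poly_approx D F -> poly_approx D (fun x => F x ^+ n).
Proof.
move=> hF; elim: n => [|n IH]; first exact: poly_approx_cst.
apply: poly_approx_ext (poly_approxM _ _ hF IH) => x _.
by rewrite exprS.
Qed.

Lemma poly_approx_horner (T : {poly K}) F :
  poly_approx D F -> poly_approx D (fun x => T.[F x]).
Proof.
move=> hF; elim/poly_ind: T => [|T c IH].
  by apply: poly_approx_ext (poly_approx_cst 0) => x _; rewrite horner0.
apply: poly_approx_ext (poly_approxD _ _ (poly_approxM _ _ IH hF) (poly_approx_cst c)).
by move=> x _; rewrite hornerMXaddC.
Qed.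

Lemma poly_approx_lim F :
  (forall e : R, 0 < e ->
     exists G, poly_approx D G /\ forall x, D x -> abs (F x - G x) <= e) ->
  poly_approx D F.
Proof.
move=> h; split.
  have [G [[[C hC] _] hG]] := h 1 ltr01.
  exists (Num.max 1 C) => x dx; rewrite -(subrK (G x) (F x)).
  by apply: abs_leD; rewrite le_max ?hG ?hC ?orbT.
move=> e e0; have [G [[_ hG] hFG]] := h e e0; have [T hT] := hG e e0.
by exists T => x dx; apply: (abs_leT _ _ (G x)); [apply: hFG | apply: hT].
Qed.

End PolyApprox.

(* A function uniformly approximable on a ball behaves there like an analytic
   function: unless it is dominated by its value at one point, it nearly
   vanishes somewhere. *)
Lemma poly_approx_root F a r l u : 0 < abs (F l - F u) ->
  poly_approx (fun x => abs (x - a) <= r) F ->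
  abs (l - a) <= r -> abs (u - a) <= r -> abs (F u) <= abs (F l - F u) ->
  forall e : R, 0 < e -> exists x, abs (x - a) <= r /\ abs (F x) <= e.
Proof.
move=> h0 [_ hF] hl hu hlu e e0.
pose d := Num.min e (abs (F l - F u) / 2).
have d0 : 0 < d by rewrite lt_min e0 divr_gt0.
have de : d <= e by rewrite ge_min lexx.
have dlu : d < abs (F l - F u).
  by rewrite gt_min; apply/orP; right; rewrite ltr_pdivrMr //; lra.
have [T hT] := hF d d0.
have e1 : abs (T.[l] - T.[u]) = abs (F l - F u).
  apply: abs_eqB; apply: le_lt_trans dlu.
  have -> : T.[l] - T.[u] - (F l - F u) = (F u - T.[u]) - (F l - T.[l]) by ring.
  by apply: abs_leB; apply: hT.
have e2 : abs T.[u] <= abs (T.[l] - T.[u]).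
  rewrite e1 -(subrK (F u) T.[u]); apply: abs_leD => //.
  by rewrite (absB T.[u]); apply: le_trans (hT u hu) (ltW dlu).
have [x [xa xT]] := poly_root_in_ball T a r l u hl hu e2.
by exists x; split => //; apply: le_trans de; have := hT x xa; rewrite xT subr0.
Qed.

(** * Convergent power series *)

Hypothesis Kcomplete : forall u, kcauchy abs u -> exists l, kconv abs u l.

Section PowerSeries.
Variables (rhat kap : R) (a : nat -> K).
Hypothesis rhat_gt1 : 1 < rhat.
Hypothesis a_HB : in_HB abs rhat a.
Hypothesis a_le : forall i, abs (a i) * rhat ^+ i <= kap.

Local Notation psum n z := (\sum_(i < n) a i * z ^+ i).

Lemma coef_le i : abs (a i) <= abs (a i) * rhat ^+ i.
Proof. by rewrite ler_peMr // exprn_ege1 // ltW. Qed.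

Lemma psum_tail (e : R) : 0 < e -> exists N : nat, forall n z, (N <= n)%N ->
  abs z <= 1 -> abs (psum n z - psum N z) <= e.
Proof.
move=> e0; have [N hN] := a_HB e e0; exists N => n z nN z1.
rewrite -(subnKC nN); elim: (n - N)%N => [|k IH].
  by rewrite addn0 subrr abs0 ltW.
rewrite addnS big_ord_recr /= addrAC; apply: abs_leD => //.
rewrite absM absX; apply: le_trans (ltW (hN (N + k)%N (leq_addr _ _))).
have z_rhat : abs z <= rhat by apply: le_trans z1 (ltW rhat_gt1).
by apply: ler_pM; rewrite ?exprn_ge0 // lerXn2r ?nnegrE // (le_trans _ z_rhat).
Qed.

Lemma ps_evalP z : abs z <= 1 -> kconv abs (fun n => psum n z) (ps_eval abs a z).
Proof.
move=> z1; apply: (epsilon_spec (inhabits 0)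
  (fun l => kconv abs (fun n => psum n z) l)).
apply: Kcomplete => e e0; have e2 : 0 < e / 2 by rewrite divr_gt0.
have [N hN] := psum_tail (e / 2) e2; exists N => n m nN mN.
apply: (@le_lt_trans _ _ (e / 2)); last by rewrite ltr_pdivrMr //; lra.
by apply: (abs_leT _ _ (psum N z)); [|rewrite absB]; apply: hN.
Qed.

Lemma bound_ge0 : 0 <= kap.
Proof. by apply: le_trans (a_le 0); rewrite expr0 mulr1. Qed.

Lemma ps_eval_le z : abs z <= 1 -> abs (ps_eval abs a z) <= kap.
Proof.
move=> z1; rewrite -[ps_eval _ _ _]subr0.
apply: (kconv_cst_le _ _ _ _ bound_ge0 (ps_evalP z z1)); exists 0%N => n _.
rewrite subr0; apply: abs_sum => [|i]; first exact: bound_ge0.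
rewrite absM absX; apply: le_trans (a_le i).
apply: le_trans (coef_le i); rewrite ler_piMr // exprn_ile1 //.
Qed.

Lemma ps_eval_lip z w : abs z <= 1 -> abs w <= 1 ->
  abs (ps_eval abs a z - ps_eval abs a w) <= kap * abs (z - w).
Proof.
move=> z1 w1; rewrite -[X in abs X]subr0.
have b0 : 0 <= kap * abs (z - w) by rewrite mulr_ge0 // bound_ge0.
apply: (kconv_cst_le (fun n => psum n z - psum n w) _ 0 _ b0).
  move=> e e0; have [N hN] := ps_evalP z z1 e e0.
  have [M hM] := ps_evalP w w1 e e0; exists (maxn N M) => n.
  rewrite geq_max => /andP[/hN h1 /hM h2].
  have -> (x y u v : K) : (x - y) - (u - v) = (x - u) - (y - v) by ring.
  exact: abs_ltB.
exists 0%N => n _; rewrite subr0 -sumrB; apply: abs_sum => [|i] //.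
rewrite -mulrBr absM; apply: ler_pM => //; last exact: subX_le.
exact: le_trans (coef_le i) (a_le i).
Qed.

Lemma ps_eval_poly (e : R) : 0 < e -> exists T : {poly K},
  forall z, abs z <= 1 -> abs (ps_eval abs a z - T.[z]) <= e.
Proof.
move=> e0; have [N hN] := psum_tail e e0; exists (\poly_(i < N) a i) => z z1.
rewrite horner_poly; apply: (kconv_cst_le _ _ _ _ (ltW e0) (ps_evalP z z1)).
by exists N => n nN; apply: hN.
Qed.

End PowerSeries.

(** * Itineraries *)

Section Itinerary.
Variables (g : K -> K) (c : K) (s : R) (E : nat -> R).
Hypothesis g1 : g 1 = 1.
Hypothesis g_itin : forall w, abs (w - c) <= s -> forall t, abs (iter t g w - 1) = E t.
Hypothesis E_bound : forall t, 0 < E t <= 1.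
Hypothesis E_small : forall (d : R) N, 0 < d -> exists2 t, (N <= t)%N & E t < d.
Hypothesis E_one : forall N, exists2 t, (N <= t)%N & E t = 1.

Lemma finite_positive_lower_bound (u : nat -> R) m : (forall t, (t < m)%N -> 0 < u t) ->
  exists2 d, 0 < d & forall t, (t < m)%N -> d <= u t.
Proof.
elim: m => [|m IH] hu; first by exists 1.
have [|d d0 hd] := IH; first by move=> t tm; apply: hu; apply: leqW.
exists (Num.min d (u m)); first by rewrite lt_min d0 hu.
move=> t; rewrite ltnS leq_eqVlt => /orP[/eqP->|/hd h].
  by rewrite ge_min lexx orbT.
by rewrite ge_min h.
Qed.

(** If the images at times [n < m] meet, then [E] is periodic from time [n] on, so it has finitely
    many values, all positive, which [E_small] excludes. *)
Lemma itinerary_wandering : wandering g (cball abs c s).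
Proof.
suff lt_absurd n m z1 z2 : (n < m)%N -> cball abs c s z1 -> cball abs c s z2 ->
    iter n g z1 = iter m g z2 -> False.
  move=> n m [z1 [z2 [h1 [h2 e]]]]; have [nm|mn|//] := ltngtP n m.
    by case: (lt_absurd n m z1 z2).
  by case: (lt_absurd m n z2 z1).
move=> nm h1 h2 e.
have per t : E (t + n)%N = E (t + m)%N.
  by rewrite -(g_itin z1 h1) -(g_itin z2 h2) !iterD e.
have fin t : exists2 r, (r < m)%N & E t = E r.
  elim/ltn_ind: t => t IH; have [tm|mt] := ltnP t m; first by exists t.
  have [|r rm er] := IH (t - m + n)%N; last by exists r => //; rewrite -er per subnK.
  by rewrite -{2}(subnK mt) ltn_add2l.
have [d d0 hd] := finite_positive_lower_bound E m
  (fun t _ => proj1 (andP (E_bound t))).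
have [t _ td] := E_small d 0%N d0; have [r rm er] := fin t.
by move: td; rewrite er ltNge hd.
Qed.

(** By [E_small], a cycle attracting the orbit must contain the fixed point 1, hence reduces to it;
    but by [E_one] the orbit is at distance 1 from it infinitely often. *)
Lemma itinerary_not_attracted rhat : not_attracted abs rhat g (cball abs c s).
Proof.
move=> [z0 [k [[k0 _ zk _] [x [c' [s' [xD s0 xc hb]]]]]]].
have [_ hx] := hb x xc; have ex t := g_itin x xD t.
have it1 i : iter i g 1 = 1 by elim: i => //= i ->.
have [j jk zj] : exists2 j, (j < k)%N & iter j g z0 = 1.
  apply: NNPP => hno.
  have [|d d0 hd] := finite_positive_lower_bound (fun j => abs (iter j g z0 - 1)) k.
    move=> j jk; rewrite abs_gt0 subr_eq0; apply/eqP => zj.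
    by apply: hno; exists j.
  have [N hN] := hx d d0; have [t Nt td] := E_small d N d0.
  have [j [jk hj]] := hN t Nt.
  suff: abs (iter j g z0 - 1) < d by rewrite ltNge hd.
  rewrite -(subrK (iter t g x) (iter j g z0)) -addrA.
  by apply: abs_ltD; [rewrite absB | rewrite ex].
have z01 : z0 = 1 by rewrite -zk -(subnK (ltnW jk)) iterD zj it1.
have [N hN] := hx 1 ltr01; have [t Nt t1] := E_one N.
have [i [_ hi]] := hN t Nt.
by move: hi; rewrite z01 it1 ex t1 ltxx.
Qed.

End Itinerary.

(** * The family f_l *)

Variables (p : nat) (rho kap : R) (Q : K -> K).
Hypothesis p_pr : prime p.
Hypothesis absp : abs p%:R = (p%:R)^-1.
Hypothesis rho_gt0 : 0 < rho.
Hypothesis rho_p : rho ^+ p.-1 = (p%:R)^-1.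
Hypothesis kap_ge0 : 0 <= kap.
Hypothesis kap_rho : kap < rho.
Hypothesis Q_le : forall z, abs z <= 1 -> abs (Q z) <= kap.
Hypothesis Q_lip : forall z w, abs z <= 1 -> abs w <= 1 ->
  abs (Q z - Q w) <= kap * abs (z - w).
Hypothesis Q_poly : forall e : R, 0 < e ->
  exists T : {poly K}, forall z, abs z <= 1 -> abs (Q z - T.[z]) <= e.

Local Notation pR := (p%:R : R).
Local Notation pK := (p%:R : K).

Lemma pR_gt1 : 1 < pR. Proof. by rewrite ltr1n prime_gt1. Qed.
Lemma pR_gt0 : 0 < pR. Proof. exact: lt_trans ltr01 pR_gt1. Qed.

Lemma pK_neq0 : pK != 0.
Proof. by rewrite -abs_gt0 absp invr_gt0 pR_gt0. Qed.

Lemma invp_lt1 : pR^-1 < 1.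
Proof. by rewrite invf_lt1 ?pR_gt0 ?pR_gt1. Qed.

Lemma invp_gt0 : 0 < pR^-1. Proof. by rewrite invr_gt0 pR_gt0. Qed.

Lemma rho_lt1 : rho < 1.
Proof.
rewrite ltNge; apply/negP => h.
have: 1 <= rho ^+ p.-1 by apply: exprn_ege1.
by rewrite rho_p leNgt invp_lt1.
Qed.

Lemma expp (x : R) : x ^+ p = x * x ^+ p.-1.
Proof. by rewrite -exprS prednK ?prime_gt0. Qed.

Lemma exprp1_le (x : R) : 0 <= x -> x <= 1 -> x ^+ p.-1 <= x.
Proof.
move=> x0 x1; have -> : p.-1 = p.-2.+1 by rewrite prednK // -subn1 subn_gt0 prime_gt1.
by rewrite exprSr ler_piMl // exprn_ile1.
Qed.

Lemma invp_le_rho : pR^-1 <= rho.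
Proof. by rewrite -rho_p exprp1_le ?ltW // rho_lt1. Qed.

(* [|f l z| = tau |z|] on the annulus [rho < |z| < 1]; [rho] is a repelling
   fixed point of [tau]. *)
Definition tau (r : R) : R := pR * r ^+ p.

Lemma tau_rho : tau rho = rho.
Proof. by rewrite /tau expp rho_p mulrCA divff ?mulr1 // gt_eqF // pR_gt0. Qed.

Lemma tau_le r s : 0 <= r -> r <= s -> tau r <= tau s.
Proof.
move=> r0 rs; rewrite ler_pM2l ?pR_gt0 // lerXn2r // nnegrE //.
exact: le_trans rs.
Qed.

Lemma tau_lt r s : 0 <= r -> r < s -> tau r < tau s.
Proof.
by move=> r0 rs; rewrite ltr_pM2l ?pR_gt0 // ltrXn2r ?nnegrE -?lt0n ?prime_gt0 //.
Qed.

Lemma tau_gt_rho r : rho < r -> rho < tau r.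
Proof. by move=> h; rewrite -tau_rho; apply: tau_lt => //; apply: ltW. Qed.

Definition f (l z : K) : K := P_lam p l z + Q z.

(** The parameter is confined to the first summand, which carries the denominator [p]. *)
Lemma fE l z : f l z = l / pK * (z ^+ p * (1 - z)) + (z ^+ p.+1 + Q z).
Proof. by rewrite /f /P_lam exprSr; ring. Qed.

Lemma f_param l u z : f l z - f u z = (l - u) / pK * (z ^+ p * (1 - z)).
Proof. by rewrite !fE; ring. Qed.

Lemma abs_divp l x : abs (l / pK * x) = abs l * (pR * abs x).
Proof. by rewrite absM absf absp invrK mulrA. Qed.

Lemma abs_unit l : abs (l - 1) < 1 -> abs l = 1.
Proof. by move=> h; rewrite -abs1; apply: abs_eqB; rewrite abs1. Qed.

Lemma abs_1sub z : abs z < 1 -> abs (1 - z) = 1.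
Proof.
by move=> h; rewrite addrC -[RHS]abs1; apply: abs_addl; rewrite absN abs1.
Qed.

Lemma f_small l z : abs l = 1 -> abs z < 1 ->
  abs (f l z) <= Num.max (tau (abs z)) kap.
Proof.
move=> l1 z1; rewrite fE; apply: abs_leD.
  by rewrite abs_divp l1 mul1r absM absX abs_1sub // mulr1 le_max lexx.
apply: abs_leD; last by rewrite le_max Q_le ?orbT // ltW.
rewrite absX le_max; apply/orP; left; rewrite /tau exprS ler_wpM2r ?exprn_ge0 //.
by apply: ltW; apply: lt_trans pR_gt1.
Qed.

Lemma f_rho l z : abs l = 1 -> abs z <= rho -> abs (f l z) <= rho.
Proof.
move=> l1 zr; apply: le_trans (f_small l z l1 (le_lt_trans zr rho_lt1)) _.
by rewrite ge_max (ltW kap_rho) andbT -tau_rho tau_le.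
Qed.

Lemma f_mid l z : abs l = 1 -> abs z < 1 -> kap < tau (abs z) ->
  abs (f l z) = tau (abs z).
Proof.
move=> l1 z1 hk; rewrite fE addrC.
have e : abs (l / pK * (z ^+ p * (1 - z))) = tau (abs z).
  by rewrite abs_divp l1 mul1r absM absX abs_1sub // mulr1.
rewrite abs_addl e //; apply: abs_ltD; last first.
  by apply: le_lt_trans hk; apply: Q_le; apply: ltW.
have z0 : 0 < abs z ^+ p.
  have := le_lt_trans kap_ge0 hk.
  by rewrite pmulr_rgt0 ?pR_gt0.
by rewrite absX /tau exprS ltr_pM2r //; apply: lt_trans pR_gt1.
Qed.

Lemma f_mid_rho l z : abs l = 1 -> abs z < 1 -> rho < abs z ->
  abs (f l z) = tau (abs z).
Proof.
move=> l1 z1 h; apply: f_mid => //.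
by apply: lt_trans kap_rho _; apply: tau_gt_rho.
Qed.

Lemma subX1_split (z w : K) :
  z ^+ p * (1 - z) - w ^+ p * (1 - w) =
  (z ^+ p - w ^+ p) * (1 - z) - w ^+ p * (z - w).
Proof. by ring. Qed.

Lemma f_sub l z w : f l z - f l w =
  l / pK * ((z ^+ p - w ^+ p) * (1 - z) - w ^+ p * (z - w)) +
  ((z ^+ p.+1 - w ^+ p.+1) + (Q z - Q w)).
Proof. by rewrite -subX1_split !fE; ring. Qed.

Lemma kap_lt1 : kap < 1. Proof. exact: lt_trans rho_lt1. Qed.

Lemma Q_lip1 z w : abs z <= 1 -> abs w <= 1 -> abs (Q z - Q w) <= abs (z - w).
Proof.
by move=> hz hw; apply: le_trans (Q_lip z w hz hw) _; rewrite ler_piMl // ltW ?kap_lt1.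
Qed.

Lemma le_pM (x : R) : 0 <= x -> x <= pR * x.
Proof. by move=> x0; rewrite ler_peMl // ltW // pR_gt1. Qed.

(** Near 1 the term [l / p * w ^+ p * (z - w)] of [f_sub] has absolute value [p * abs (z - w)]. The
    rest is strictly smaller when [z] and [w] differ, because [abs (1 - z) < 1] and
    [z ^+ p.+1 + Q z] is 1-Lipschitz on the unit ball. *)
Lemma f_expand l z w : abs l = 1 -> abs (z - 1) < 1 -> abs (w - 1) < 1 ->
  abs (f l z - f l w) = pR * abs (z - w).
Proof.
move=> l1 hz hw; have z1 := abs_unit z hz; have w1 := abs_unit w hw.
have [->|zw] := eqVneq z w; first by rewrite !subrr abs0 mulr0.
have zw0 : 0 < abs (z - w) by rewrite abs_gt0 subr_eq0.
have e : abs (l / pK * ((z ^+ p - w ^+ p) * (1 - z) - w ^+ p * (z - w))) =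
    pR * abs (z - w).
  rewrite abs_divp l1 mul1r; congr (_ * _).
  have e : abs (- (w ^+ p * (z - w))) = abs (z - w).
    by rewrite absN absM absX w1 expr1n mul1r.
  rewrite abs_addl e // absM; apply: le_lt_trans (_ : _ <= abs (z - w) * abs (1 - z)) _.
    by rewrite ler_wpM2r // subX_le ?z1 ?w1.
  by rewrite gtr_pMr // absB.
rewrite f_sub addrC abs_addl e //; apply: le_lt_trans (_ : _ <= abs (z - w)) _.
  by apply: abs_leD; [apply: subX_le | apply: Q_lip1]; rewrite ?z1 ?w1.
by rewrite ltr_pMl // pR_gt1.
Qed.

(** The rate [tau q] comes from the term [l / p * w ^+ p * (z - w)]; the bound [p^-2] on
    [abs (z - w)] keeps the [p]-th power in [abs_subXp] below it. *)
Lemma f_contract l q z w : abs l = 1 -> rho < q -> q < 1 ->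
  abs z <= q -> abs w <= q -> abs (z - w) <= pR^-1 ^+ 2 ->
  abs (f l z - f l w) <= tau q * abs (z - w).
Proof.
move=> l1 rq q1 hz hw hzw; have q0 : 0 < q by apply: lt_trans rq.
have z1 : abs z <= 1 by apply: le_trans hz (ltW q1).
have w1 : abs w <= 1 by apply: le_trans hw (ltW q1).
set d := abs (z - w) in hzw *.
have d0 : 0 <= d by apply: abs_ge0.
have rt := tau_gt_rho q rq.
have ipq : pR^-1 <= q by apply: le_trans invp_le_rho (ltW rq).
rewrite f_sub; apply: abs_leD.
  rewrite abs_divp l1 mul1r /tau -mulrA ler_pM2l ?pR_gt0 //.
  apply: abs_leB; rewrite absM.
    rewrite abs_1sub ?(le_lt_trans hz) // mulr1.
    apply: le_trans (abs_subXp p z w q p_pr hz hw) _; rewrite -/d ge_max.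
    apply/andP; split.
      rewrite expp mulrC ler_wpM2r //.
      have d1 : d <= 1.
        by apply: le_trans hzw _; rewrite exprn_ile1 ?ltW ?invp_gt0 ?invp_lt1.
      apply: le_trans (exprp1_le d d0 d1) _; apply: le_trans hzw _.
      rewrite expr2 -(ler_pM2l pR_gt0) mulrA divff ?mul1r ?gt_eqF ?pR_gt0 //.
      by apply: le_trans invp_le_rho (ltW rt).
    by rewrite absp expp ler_wpM2r // ler_wpM2r // exprn_ge0 // ltW.
  by rewrite absX ler_wpM2r // lerXn2r // nnegrE // ltW.
apply: abs_leD.
  apply: le_trans (abs_subX p z w q hz hw) _; rewrite ler_wpM2r //.
  by apply: le_pM; rewrite exprn_ge0 // ltW.
apply: le_trans (Q_lip z w z1 w1) _; rewrite ler_wpM2r //.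
by apply: ltW; apply: lt_trans kap_rho rt.
Qed.

Lemma expr_small (t e : R) : 0 <= t -> t < 1 -> 0 < e ->
  exists N : nat, forall n, (N <= n)%N -> t ^+ n < e.
Proof.
move=> t0 t1 e0; have [->|tn] := eqVneq t 0.
  by exists 1%N => -[|n] // _; rewrite expr0n.
have tp : 0 < t by rewrite lt_def tn.
pose a := t^-1 - 1.
have a0 : 0 < a by rewrite subr_gt0 invf_gt1.
have bern n : 1 + n%:R * a <= t^-1 ^+ n.
  elim: n => [|n IH]; first by rewrite mul0r addr0 expr0.
  have h : (1 + n%:R * a) * t^-1 <= t^-1 ^+ n.+1.
    by rewrite exprSr ler_wpM2r // invr_ge0.
  apply: le_trans h; have -> : t^-1 = 1 + a by rewrite /a; ring.
  have n0 : 0 <= n%:R :> R by [].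
  by rewrite -natr1; nra.
exists (Num.bound (e^-1 / a)) => n hn.
have h1 : e^-1 < n%:R * a.
  rewrite -ltr_pdivrMr //; apply: lt_le_trans (_ : (Num.bound (e^-1 / a))%:R <= _).
    by apply: archi_boundP; rewrite divr_ge0 ?invr_ge0 // ltW.
  by rewrite ler_nat.
have h2 : e^-1 < t^-1 ^+ n by apply: lt_le_trans (bern n); lra.
by rewrite exprVn ltf_pV2 // ?posrE ?exprn_gt0 in h2.
Qed.

Lemma invp_small (e : R) : 0 < e -> exists N : nat,
  forall n, (N <= n)%N -> pR^-1 ^+ n < e.
Proof. by apply: expr_small; [apply: ltW invp_gt0 | apply: invp_lt1]. Qed.

(** * The fixed point h(l) *)

(* The fixed points of [Phi l] are those of [f l], but the point 1, repelling
   for [f l], becomes attracting for [Phi l]. *)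
Definition Phi (l z : K) : K := z + pK * (f l z - z).

Definition Phi_rate (l : K) : R := Num.max (abs (l - 1)) pR^-1.

Lemma Phi_rate_lt1 l : abs (l - 1) < 1 -> Phi_rate l < 1.
Proof. by move=> h; rewrite gt_max h invp_lt1. Qed.

Lemma Phi_rate_ge0 l : 0 <= Phi_rate l.
Proof. by rewrite le_max abs_ge0. Qed.

Lemma near1 z : abs (z - 1) <= pR^-1 -> abs (z - 1) < 1.
Proof. by move=> h; apply: le_lt_trans h invp_lt1. Qed.

(** The main coefficient of [z - w] is [1 - l * w ^+ p], of size at most [Phi_rate l]; each other
    term has a factor [p] or [1 - z], of absolute value at most [1 / p]. *)
Lemma Phi_contract l z w : abs (l - 1) < 1 ->
  abs (z - 1) <= pR^-1 -> abs (w - 1) <= pR^-1 ->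
  abs (Phi l z - Phi l w) <= Phi_rate l * abs (z - w).
Proof.
move=> hl hz hw; have l1 := abs_unit l hl.
have z1 : abs z <= 1 by rewrite abs_unit ?near1.
have w1 : abs w <= 1 by rewrite abs_unit ?near1.
have -> : Phi l z - Phi l w = (z - w) * (1 - l * w ^+ p) +
   ((z ^+ p - w ^+ p) * (l * (1 - z)) +
    ((z ^+ p.+1 - w ^+ p.+1) + (Q z - Q w) - (z - w)) * pK).
  have e : Phi l z - Phi l w = (z - w) + pK * (f l z - f l w) - pK * (z - w).
    by rewrite /Phi; ring.
  rewrite e f_sub; field; exact: pK_neq0.
have ir : pR^-1 <= Phi_rate l by rewrite le_max lexx orbT.
have d0 := abs_ge0 (z - w).
apply: abs_leD.
  rewrite absM mulrC ler_wpM2r //.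
  have -> : 1 - l * w ^+ p = l * (1 ^+ p - w ^+ p) + (1 - l).
    by rewrite expr1n; ring.
  apply: abs_leD; last by rewrite absB le_max lexx.
  rewrite absM l1 mul1r; apply: le_trans ir; apply: le_trans (subX_le _ _ _ _ _) _.
  - by rewrite abs1.
  - exact: w1.
  - by rewrite absB.
apply: abs_leD; rewrite absM mulrC; apply: ler_pM => //.
- by rewrite absM l1 mul1r absB; apply: le_trans ir.
- exact: subX_le.
- by rewrite absp.
apply: abs_leB => //.
by apply: abs_leD; [apply: subX_le | apply: Q_lip1].
Qed.

(** Radius of the ball in which [hfix] is chosen; it equals [abs (Phi l 1 - 1)], the first
    displacement of the iteration below. *)
Definition q1 : R := abs (Q 1) / pR.

Lemma q1_le : q1 <= pR^-1.
Proof.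
rewrite /q1 ler_piMl ?ltW ?invp_gt0 //.
by apply: le_lt_trans kap_lt1; apply: Q_le; rewrite abs1.
Qed.

Lemma q1_ge0 : 0 <= q1.
Proof. by rewrite divr_ge0 // ltW // pR_gt0. Qed.

Lemma Phi_ball l z : abs (l - 1) < 1 -> abs (z - 1) <= q1 -> abs (Phi l z - 1) <= q1.
Proof.
move=> hl hz; apply: (abs_leT _ _ (Phi l 1)).
  apply: le_trans (Phi_contract l z 1 hl _ _) _.
  - exact: le_trans q1_le.
  - by rewrite subrr abs0 ltW ?invp_gt0.
  apply: le_trans hz; rewrite ler_piMl // ltW //; exact: Phi_rate_lt1.
have -> : Phi l 1 - 1 = Q 1 * pK.
  by rewrite /Phi fE !expr1n; ring.
by rewrite absM absp.
Qed.

Lemma iter_Phi_ball l k : abs (l - 1) < 1 -> abs (iter k (Phi l) 1 - 1) <= q1.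
Proof.
move=> hl; elim: k => [|k IH] /=; first by rewrite subrr abs0 q1_ge0.
exact: Phi_ball.
Qed.

Lemma iter_Phi_near l k z w : abs (l - 1) < 1 ->
  abs (z - 1) <= q1 -> abs (w - 1) <= q1 ->
  abs (iter k (Phi l) z - iter k (Phi l) w) <= Phi_rate l ^+ k.
Proof.
move=> hl hz hw.
have hb k' x : abs (x - 1) <= q1 -> abs (iter k' (Phi l) x - 1) <= q1.
  by elim: k' => //= k' IH hx; apply: Phi_ball => //; apply: IH.
elim: k => [|k IH] /=.
  rewrite expr0; apply: (abs_leT _ _ 1); rewrite 1?(absB 1).
    by apply: le_trans hz _; apply: le_trans q1_le (ltW invp_lt1).
  by apply: le_trans hw _; apply: le_trans q1_le (ltW invp_lt1).
apply: le_trans (Phi_contract l _ _ hl _ _) _.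
- by apply: le_trans q1_le; apply: hb.
- by apply: le_trans q1_le; apply: hb.
by rewrite exprS ler_wpM2l // Phi_rate_ge0.
Qed.

(** Banach iteration of the contraction [Phi l], started at 1. *)
Lemma fixed_point_exists l : abs (l - 1) < 1 ->
  exists z, abs (z - 1) <= q1 /\ f l z = z.
Proof.
move=> hl; pose u k := iter k (Phi l) 1.
have ub k : abs (u k - 1) <= q1 by apply: iter_Phi_ball.
have tail k n : (k <= n)%N -> abs (u n - u k) <= Phi_rate l ^+ k.
  move=> kn; rewrite /u -{1}(subnKC kn) iterD.
  by apply: iter_Phi_near => //; rewrite ?subrr ?abs0 ?q1_ge0 ?ub.
have small e := expr_small (Phi_rate l) e (Phi_rate_ge0 l) (Phi_rate_lt1 l hl).
have [z hz] : exists z, kconv abs u z.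
  apply: Kcomplete => e /small [N hN]; exists N => n m hn hm.
  apply: le_lt_trans (hN N (leqnn N)).
  by apply: (abs_leT _ _ (u N)); [|rewrite absB]; apply: tail.
have zb : abs (z - 1) <= q1.
  by apply: (kconv_cst_le u) => //; [apply: q1_ge0 | exists 0%N => n _].
exists z; split => //.
have e : Phi l z - z = 0.
  apply/abs_eq0/eqP; rewrite eq_le abs_ge0 andbT leNgt; apply/negP => h0.
  have [N hN] := hz _ h0.
  suff: abs (Phi l z - z) < abs (Phi l z - z) by rewrite ltxx.
  rewrite -{1}(subrK (u N.+1) (Phi l z)) -addrA; apply: abs_ltD; last first.
    by apply: hN; rewrite leqnSn.
  apply: le_lt_trans (Phi_contract l z (u N) hl _ _) _.
  - exact: le_trans q1_le.
  - exact: le_trans q1_le.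
  apply: le_lt_trans (hN N (leqnn N)); rewrite (absB z) ler_piMl // ltW //.
  exact: Phi_rate_lt1.
move: e; rewrite /Phi addrC addKr => /eqP; rewrite mulf_eq0 (negbTE pK_neq0) /=.
by rewrite subr_eq0 => /eqP.
Qed.

Variable h : K -> K.
Hypothesis h_fix : forall l, abs (l - 1) < 1 -> abs (h l - 1) <= q1 /\ f l (h l) = h l.

Lemma h_near l : abs (l - 1) < 1 -> abs (h l - 1) <= pR^-1.
Proof. by case/h_fix => hl _; apply: le_trans q1_le. Qed.

(** If the fixed points were farther apart than the parameters, expansion by [p] would outweigh the
    change of parameter, and [abs (h l - h u)] would equal [p] times itself. *)
Lemma h_lip l u : abs (l - 1) < 1 -> abs (u - 1) < 1 -> abs (h l - h u) <= abs (l - u).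
Proof.
move=> hl hu; have [_ el] := h_fix l hl; have [_ eu] := h_fix u hu.
have nl := h_near l hl; have nu := h_near u hu.
rewrite leNgt; apply/negP => lt; set d := abs (h l - h u) in lt.
have d0 : 0 < d by apply: le_lt_trans lt.
have e1 : abs (f l (h l) - f l (h u)) = pR * d.
  by apply: f_expand; [apply: abs_unit | apply: near1 | apply: near1].
have dp : d < pR * d by rewrite ltr_pMl // pR_gt1.
suff: d = pR * d by move=> e; move: dp; rewrite -e ltxx.
rewrite {1}/d -{1}el -{1}eu -(subrK (f l (h u)) (f l (h l))) -addrA addrC -e1.
apply: abs_addl; rewrite e1 f_param abs_divp absM absX (abs_unit (h u) (near1 _ nu)).
rewrite expr1n mul1r; apply: lt_trans dp; apply: le_lt_trans lt.
rewrite ler_piMr // -ler_pdivlMl ?pR_gt0 // mulr1 absB; exact: nu.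
Qed.

(** * Analytic dependence of orbits and of the fixed point on the parameter *)

Section ApproxDynamics.
Variables (D : K -> Prop) (r0 : R).
Hypothesis D_le : forall l, D l -> abs (l - 1) <= r0.
Hypothesis r0_lt1 : r0 < 1.

Lemma poly_approx_idD : poly_approx D id.
Proof. exact: (poly_approx_id D 1 r0). Qed.

Lemma poly_approx_f F : poly_approx D F -> (forall l, D l -> abs (F l) <= 1) ->
  poly_approx D (fun l => f l (F l)).
Proof.
move=> hF F1.
have hQ : poly_approx D (fun l => Q (F l)).
  apply: poly_approx_lim => e /Q_poly [T hT].
  by exists (fun l => T.[F l]); split; [apply: poly_approx_horner | move=> l /F1 /hT].
have hip := poly_approxM D _ _ poly_approx_idD (poly_approx_cst D pK^-1).
have hm := poly_approxD D _ _ (poly_approx_cst D 1)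
   (poly_approxM D _ _ hip (poly_approx_cst D (-1))).
apply: poly_approx_ext (poly_approxD D _ _ (poly_approxD D _ _
  (poly_approxM D _ _ hip (poly_approxX D _ p hF))
  (poly_approxM D _ _ hm (poly_approxX D _ p.+1 hF))) hQ).
by move=> l _; rewrite /f /P_lam mulrN1.
Qed.

(** [h] is the limit of [iter N (Phi l) 1], and [r0 < 1] makes the convergence uniform in [l]. *)
Lemma poly_approx_h : poly_approx D h.
Proof.
pose t := Num.max r0 pR^-1.
have [hD|nD] := excluded_middle_informative (exists l, D l); last first.
  apply: poly_approx_ext (poly_approx_cst D 0) => l dl.
  by case: nD; exists l.
have t0 : 0 <= t by rewrite le_max (ltW invp_gt0) orbT.
have t1 : t < 1 by rewrite gt_max r0_lt1 invp_lt1.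
have L1 l : D l -> abs (l - 1) < 1 by move=> /D_le hl; apply: le_lt_trans r0_lt1.
apply: poly_approx_lim => e /(expr_small t e t0 t1) [N hN].
exists (fun l => iter N (Phi l) 1); split.
  elim: N {hN} => [|N IH] /=; first exact: poly_approx_cst.
  have hf : poly_approx D (fun l => f l (iter N (Phi l) 1)).
    apply: poly_approx_f => // l /L1 dl.
    have := iter_Phi_ball l N dl => /le_trans /(_ q1_le) /near1 /abs_unit ->.
    exact: lexx.
  have h1 := poly_approxD D _ _ hf (poly_approxM D _ _ IH (poly_approx_cst D (-1))).
  have h2 := poly_approxM D _ _ (poly_approx_cst D pK) h1.
  apply: poly_approx_ext (poly_approxD D _ _ IH h2) => l _.
  by rewrite mulrN1 /Phi.
move=> l dl; have hl := L1 l dl; have [hb hf] := h_fix l hl.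
have fixN : iter N (Phi l) (h l) = h l.
  by elim: N {hN} => //= N ->; rewrite /Phi hf subrr mulr0 addr0.
rewrite -{1}fixN; apply: le_trans (iter_Phi_near l N _ _ hl hb _) _.
  by rewrite subrr abs0 q1_ge0.
apply: le_trans (ltW (hN N (leqnn N))).
rewrite lerXn2r ?nnegrE ?Phi_rate_ge0 //.
by rewrite ge_max !le_max D_le // lexx orbT.
Qed.

Lemma poly_approx_iter (x : K -> K) n : poly_approx D x ->
  (forall j l, (j < n)%N -> D l -> abs (iter j (f l) (x l)) <= 1) ->
  poly_approx D (fun l => iter n (f l) (x l)).
Proof.
elim: n => [|n IH] // hx hj; apply: poly_approx_f => [|l]; last exact: hj.
by apply: IH => // j l jn; apply: hj; apply: ltnW.
Qed.

End ApproxDynamics.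

(** * Orbits of pairs of parameters *)

(** Radii are pulled back under [tau], which maps the interval from [rho] to 1 onto that from [rho]
    to [p]; a [p]-th root of [p * y] realises each preimage in [K]. The bound [abs y < pR] serves
    the induction. *)
Lemma tau_chain M : exists y : K,
  [/\ rho < abs y, abs y < pR,
      forall j, (j < M)%N -> rho < iter j tau (abs y) < 1 &
      1 < iter M tau (abs y)].
Proof.
elim: M => [|M [y [y1 y2 hy hM]]].
  (* [abs w] is the square root of [p], strictly between 1 and [p]. *)
  have [w hw] := exists_nth_root 1 pK^-1.
  have e : abs w ^+ 2 = pR by rewrite -absX hw absV absp invrK.
  have w0 := abs_ge0 w; have p1 := pR_gt1; have r1 := rho_lt1.
  have w1 : 1 < abs w by rewrite expr2 in e; nra.
  exists w; split => //=; first exact: lt_trans w1.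
  by rewrite -e expr2; nra.
have [x hx] := exists_nth_root p.-1 (pK * y); rewrite prednK ?prime_gt0 // in hx.
have e : tau (abs x) = abs y.
  by rewrite /tau -absX hx absM absp mulrA divff ?mul1r // gt_eqF // pR_gt0.
have x0 := abs_ge0 x.
have x1 : rho < abs x.
  rewrite ltNge; apply/negP => hr; have := tau_le _ _ x0 hr.
  by rewrite e tau_rho leNgt y1.
have x2 : abs x < 1.
  rewrite ltNge; apply/negP => hr; have := tau_le _ _ ler01 hr.
  by rewrite e /tau expr1n mulr1 leNgt y2.
exists x; split => //; first exact: lt_trans pR_gt1.
  by move=> [|j] hj; [rewrite /= x1 | rewrite iterSr e hy].
by rewrite iterSr e.
Qed.

(** The radius [t] satisfies [tau t = 1]. Radii with image at most 1 are at most [t], which is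
    therefore a uniform contraction rate for all steps of a climb but the last. *)
Lemma tau_root : exists t : R, [/\ 0 < t, t < 1 & t ^+ p = pR^-1].
Proof.
have [x hx] := exists_nth_root p.-1 pK; rewrite prednK ?prime_gt0 // in hx.
have e : abs x ^+ p = pR^-1 by rewrite -absX hx absp.
exists (abs x); split => //.
  rewrite abs_gt0; apply: contraNneq pK_neq0 => x0.
  by rewrite -hx x0 expr0n gtn_eqF // prime_gt0.
rewrite ltNge; apply/negP => h1; have := exprn_ege1 p h1.
by rewrite e leNgt invp_lt1.
Qed.

Lemma orbit_rho l z n : abs (l - 1) < 1 -> abs z <= rho ->
  abs (iter n (f l) z) <= rho.
Proof.
by move=> hl hz; elim: n => //= n; apply: f_rho; apply: abs_unit.
Qed.

Lemma orbit_le l z r M : abs (l - 1) < 1 -> abs z <= r ->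
  (forall j, (j < M)%N -> rho < iter j tau r < 1) ->
  forall j, (j <= M)%N -> abs (iter j (f l) z) <= iter j tau r.
Proof.
move=> hl hz hr; elim=> [|j IH] // jM.
have /andP[r1 r2] := hr j jM; have hj := IH (ltnW jM).
rewrite iterS; apply: le_trans (f_small l _ (abs_unit l hl) (le_lt_trans hj r2)) _.
rewrite ge_max tau_le //= ltW //; apply: lt_trans kap_rho _.
exact: tau_gt_rho.
Qed.

Lemma orbit_eq l z M : abs (l - 1) < 1 ->
  (forall j, (j < M)%N -> rho < abs (iter j (f l) z) < 1) ->
  forall j, (j <= M)%N -> abs (iter j (f l) z) = iter j tau (abs z).
Proof.
move=> hl hr; elim=> [|j IH] // jM.
have /andP[r1 r2] := hr j jM.
by rewrite iterS [RHS]iterS -IH ?(ltnW jM) //; apply: f_mid_rho => //; apply: abs_unit.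
Qed.

Lemma orbit_eq_tau l z M : abs (l - 1) < 1 ->
  (forall j, (j < M)%N -> rho < iter j tau (abs z) < 1) ->
  forall j, (j <= M)%N -> abs (iter j (f l) z) = iter j tau (abs z).
Proof.
move=> hl hr; elim=> [|j IH] // jM.
have /andP[r1 r2] := hr j jM; have e := IH (ltnW jM).
by rewrite iterS [RHS]iterS -e; apply: f_mid_rho; rewrite ?e //; apply: abs_unit.
Qed.

Local Notation e_ k := (pR^-1 ^+ k).

Lemma e_gt0 k : 0 < e_ k.
Proof. by rewrite exprn_gt0 // invp_gt0. Qed.

Lemma e_le k n : (n <= k)%N -> e_ k <= e_ n.
Proof. by apply: ler_wiXn2l; rewrite ltW ?invp_gt0 ?invp_lt1. Qed.

Lemma e_le1 k : e_ k <= 1. Proof. exact: (e_le k 0). Qed.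

Lemma e2_lt_rho : e_ 2 < rho.
Proof.
apply: lt_le_trans invp_le_rho; rewrite expr2 gtr_pMr ?invp_lt1 //.
exact: invp_gt0.
Qed.

Lemma e2_lt1 : e_ 2 < 1. Proof. exact: lt_trans e2_lt_rho rho_lt1. Qed.

Lemma pXe k m : (k <= m)%N -> pR ^+ k * e_ m = e_ (m - k).
Proof.
move=> km; rewrite -{1}(subnKC km) exprD mulrA -exprMn divff ?gt_eqF ?pR_gt0 //.
by rewrite expr1n mul1r.
Qed.

Section OrbitPair.
Variables (l u z w : K) (q : R) (N : nat).
Hypothesis hl : abs (l - 1) < 1.
Hypothesis hu : abs (u - 1) < 1.
Hypothesis hz : abs z <= q.
Hypothesis hw : abs w <= q.
Hypothesis hzw : abs (z - w) <= e_ 2.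
Hypothesis hlu : abs (l - u) <= e_ 2.
Hypothesis hq : forall j, (j < N.+1)%N -> rho < iter j tau q < 1.
Hypothesis hqN : iter N.+1 tau q <= 1.

Local Notation d j := (abs (iter j (f l) z - iter j (f u) w)).

Lemma tau_iter_le1 j : (j <= N.+1)%N -> iter j tau q <= 1.
Proof.
rewrite leq_eqVlt => /orP[/eqP->//|jN].
by have /andP[_ /ltW] := hq j jN.
Qed.

(** The intermediate point [f l (iter j (f u) w)] separates two effects: moving the point,
    controlled by [f_contract], and changing the parameter, which costs at most [abs (l - u)] times
    the next radius. *)
Lemma pair_step j : (j < N.+1)%N -> d j <= e_ 2 ->
  d j.+1 <= iter j.+1 tau q * Num.max (d j) (abs (l - u)).
Proof.
move=> jN dj; have /andP[r1 r2] := hq j jN.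
have zj := orbit_le l z q N.+1 hl hz hq j (ltnW jN).
have wj := orbit_le u w q N.+1 hu hw hq j (ltnW jN).
have q0 : 0 <= iter j.+1 tau q.
  by apply: ltW; apply: lt_trans (tau_gt_rho _ r1).
rewrite !iterS; apply: (abs_leT _ _ (f l (iter j (f u) w))).
  apply: le_trans (f_contract l _ _ _ (abs_unit l hl) r1 r2 zj wj dj) _.
  by rewrite ler_wpM2l // le_max lexx.
rewrite f_param abs_divp absM absX abs_1sub ?(le_lt_trans wj) // mulr1 mulrC.
rewrite ler_pM ?mulr_ge0 ?exprn_ge0 ?(ltW pR_gt0) //; first exact: tau_le.
by rewrite le_max lexx orbT.
Qed.

Lemma pair_small j : (j <= N.+1)%N -> d j <= e_ 2.
Proof.
elim: j => [|j IH] // jN; have dj := IH (ltnW jN).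
apply: le_trans (pair_step j jN dj) _.
rewrite -[leRHS]mul1r ler_pM ?le_max ?abs_ge0 ?tau_iter_le1 ?ge_max ?dj //.
apply: ltW; have /andP[r1 _] := hq j jN.
by apply: lt_trans (tau_gt_rho _ r1).
Qed.

(** The initial separation decays geometrically, while the change of parameter re-enters at every
    step, each time damped by [t]. *)
Lemma pair_contract t : 0 < t -> t < 1 -> t ^+ p = pR^-1 ->
  forall j, (j < N)%N -> d j.+1 <= t * Num.max (t ^+ j * abs (z - w)) (abs (l - u)).
Proof.
move=> t0 t1 tp.
have qt j : (j < N.+1)%N -> iter j tau q <= t.
  move=> jN; have h1 := tau_iter_le1 _ jN.
  have /andP[r1 _] := hq j jN.
  rewrite leNgt; apply/negP => /(tau_lt _ _ (ltW t0)).
  rewrite {1}/tau tp divff ?gt_eqF ?pR_gt0 //.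
  by rewrite ltNge -iterS h1.
have step j : (j < N)%N -> d j.+1 <= t * Num.max (d j) (abs (l - u)).
  move=> jN; have jN1 : (j < N.+1)%N by apply: leqW.
  apply: le_trans (pair_step j jN1 (pair_small j (ltnW jN1))) _.
  by rewrite ler_wpM2r ?le_max ?abs_ge0 // qt.
elim=> [|j IH] jN; first by rewrite expr0 mul1r; apply: (step 0%N).
apply: le_trans (step _ jN) _; rewrite ler_wpM2l ?(ltW t0) // ge_max.
apply/andP; split; last by rewrite le_max lexx orbT.
apply: le_trans (IH (ltnW jN)) _; rewrite maxr_pMr ?(ltW t0) // mulrA -exprS.
rewrite ge_max le_max lexx /= le_max; apply/orP; right.
by rewrite ler_piMl // ltW.
Qed.

(* As [f l w - f u w] has absolute value [|l - u| * tau |w|], the last step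
   onto the unit sphere contributes exactly [|l - u|]. *)
Lemma pair_exit : abs (iter N (f u) w) = iter N tau q -> iter N.+1 tau q = 1 ->
  d N < abs (l - u) -> d N.+1 = abs (l - u).
Proof.
move=> wN qN dN; have /andP[r1 r2] := hq N (ltnSn N).
have zj := orbit_le l z q N.+1 hl hz hq N (leqnSn N).
have wj := orbit_le u w q N.+1 hu hw hq N (leqnSn N).
have e : abs (f l (iter N (f u) w) - f u (iter N (f u) w)) = abs (l - u).
  rewrite f_param abs_divp absM absX abs_1sub ?(le_lt_trans wj) // mulr1 wN.
  by move: qN; rewrite iterS /tau => ->; rewrite mulr1.
rewrite !iterS -e -(subrK (f l (iter N (f u) w)) (f l _)) -addrA.
apply: abs_addl; rewrite e; apply: le_lt_trans dN.
apply: le_trans (f_contract l _ _ _ (abs_unit l hl) r1 r2 zj wj _) _.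
  exact: pair_small.
by move: qN; rewrite iterS => ->; rewrite mul1r.
Qed.

End OrbitPair.

Lemma near_h1 l z : abs (l - 1) < 1 -> abs (z - h l) <= pR^-1 -> abs (z - 1) < 1.
Proof. by move=> hl hz; apply: near1; apply: (abs_leT _ _ (h l)) => //; apply: h_near. Qed.

Lemma expand_orbit l z m k : abs (l - 1) < 1 -> abs (z - h l) <= e_ m ->
  (k <= m)%N -> abs (iter k (f l) z - h l) = pR ^+ k * abs (z - h l).
Proof.
move=> hl hz; elim: k => [|k IH] km; first by rewrite mul1r.
have hk := IH (ltnW km); have [hh hf] := h_fix l hl.
rewrite iterS -{1}hf exprS -mulrA -hk; apply: f_expand; first exact: abs_unit.
  apply: (near_h1 l) => //; rewrite hk.
  apply: le_trans (_ : pR ^+ k * e_ m <= _); first by rewrite ler_wpM2l ?exprn_ge0 ?(ltW pR_gt0).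
  by rewrite pXe ?(ltnW km) // -[leRHS]expr1; apply: e_le; rewrite subn_gt0.
by apply: near1; apply: h_near.
Qed.

Lemma expand_near l z m k : abs (l - 1) < 1 -> abs (z - h l) <= e_ m ->
  (k < m)%N -> abs (iter k (f l) z - 1) < 1.
Proof.
move=> hl hz km; apply: (near_h1 l) => //; rewrite (expand_orbit l z m) ?(ltnW km) //.
apply: le_trans (_ : pR ^+ k * e_ m <= _); first by rewrite ler_wpM2l ?exprn_ge0 ?(ltW pR_gt0).
by rewrite pXe ?(ltnW km) // -[leRHS]expr1; apply: e_le; rewrite subn_gt0.
Qed.

(** The change of parameter moves the image by [p * abs (l - u) * abs (b - 1)] with
    [abs (b - 1) < 1], which stays below the expanded separation. *)
Lemma expand_pair l u z w m k : abs (l - 1) < 1 -> abs (u - 1) < 1 ->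
  abs (z - h l) <= e_ m -> abs (w - h u) <= e_ m ->
  abs (l - u) <= abs (z - w) -> (k <= m)%N ->
  abs (iter k (f l) z - iter k (f u) w) = pR ^+ k * abs (z - w).
Proof.
move=> hl hu hz hw hlu; elim: k => [|k IH] km; first by rewrite mul1r.
have hk := IH (ltnW km).
have zk := expand_near l z m k hl hz km; have wk := expand_near u w m k hu hw km.
set a := iter k (f l) z in hk zk; set b := iter k (f u) w in hk wk.
have [zw|zw] := eqVneq z w.
  have lu : l = u.
    apply/eqP; rewrite -subr_eq0; apply/eqP/abs_eq0/eqP; rewrite eq_le abs_ge0 andbT.
    by move: hlu; rewrite zw subrr abs0.
  by rewrite zw lu !subrr abs0 mulr0.
have d0 : 0 < abs (z - w) by rewrite abs_gt0 subr_eq0.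
rewrite !iterS -/a -/b -(subrK (f l b) (f l a)) -addrA.
have e : abs (f l a - f l b) = pR ^+ k.+1 * abs (z - w).
  by rewrite exprS -mulrA -hk; apply: f_expand => //; apply: abs_unit.
rewrite addrC abs_addl e // f_param abs_divp absM absX (abs_unit b) // expr1n mul1r (absB 1).
apply: le_lt_trans (_ : _ <= abs (z - w) * (pR * abs (b - 1))) _.
  by rewrite ler_wpM2r // mulr_ge0 // ltW // pR_gt0.
rewrite mulrCA exprS -mulrA ltr_pM2l ?pR_gt0 //.
apply: lt_le_trans (_ : abs (z - w) <= _); first by rewrite gtr_pMr.
by rewrite ler_peMl // exprn_ege1 // ltW // pR_gt1.
Qed.

(** * Excursions and the choice of the parameter *)

Lemma abs_h l : abs (l - 1) < 1 -> abs (h l) = 1.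
Proof. by move=> hl; apply: abs_unit; apply: near1; apply: h_near. Qed.

Lemma abs_near_h l z m : abs (l - 1) < 1 -> (0 < m)%N -> abs (z - h l) <= e_ m ->
  abs z = 1.
Proof.
move=> hl m0 hz; apply: abs_unit; apply: (near_h1 l) => //.
by apply: le_trans hz _; apply: (e_le m 1).
Qed.

Lemma abs_subh l z : abs (l - 1) < 1 -> abs z < 1 -> abs (z - h l) = 1.
Proof. by move=> hl hz; rewrite abs_addl absN abs_h. Qed.

(* The orbit of [z] climbs from the annulus [rho < |z| < 1] to distance at most
   [p^-m] from the repelling fixed point [h l].  The [p * m] contracting steps
   of the climb compensate the [m] expanding steps of the escape from [h l]. *)
Definition excursion (l z : K) (m : nat) : Prop :=
  (forall j, (j < (p * m).+1)%N -> rho < abs (iter j (f l) z) < 1) /\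
  abs (iter (p * m).+1 (f l) z - h l) <= e_ m.

(** The [(p * m).+1] steps of the climb, followed by [m] steps of escape. *)
Definition elen (m : nat) : nat := (m + (p * m).+1)%N.

(** The climb contracts the disc by [p^-m] and the escape expands it by [p^m], so it does not grow.
    Throughout, it is smaller than its distance to [h l], which is thus common to all its points. *)
Lemma excursion_disc l z w m : abs (l - 1) < 1 -> (0 < m)%N ->
  excursion l z m -> abs (iter (elen m) (f l) z) < 1 -> abs (w - z) <= e_ 2 ->
  [/\ forall t, (t < elen m)%N ->
        abs (iter t (f l) w - iter t (f l) z) < abs (iter t (f l) z - h l) <= 1,
      abs (iter (elen m) (f l) w - iter (elen m) (f l) z) <= abs (w - z) &
      abs (iter (p * m).+1 (f l) z - h l) = e_ m].
Proof.
move=> hl m0 [hj hM] hend hwz.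
set N := (p * m)%N in hj hM *.
have N0 : (0 < N)%N by rewrite muln_gt0 prime_gt0.
have ztau := orbit_eq l z N.+1 hl hj.
have hq j : (j < N.+1)%N -> rho < iter j tau (abs z) < 1.
  by move=> jN; rewrite -ztau ?hj // ltnW.
have zM : abs (iter N.+1 (f l) z) = 1 by apply: (abs_near_h l _ m).
have qM : iter N.+1 tau (abs z) = 1 by rewrite -ztau.
have /andP[q0 _] := hq 0%N (ltn0Sn _).
have wq : abs w <= abs z.
  rewrite -(subrK z w); apply: abs_leD => //; apply: le_trans hwz _.
  by apply: ltW; apply: lt_trans e2_lt_rho q0.
have hll : abs (l - l) <= e_ 2 by rewrite subrr abs0 ltW // e_gt0.
have qM1 : iter N.+1 tau (abs z) <= 1 by rewrite qM.
have small := pair_small l l w z (abs z) N hl hl wq (lexx _) hwz hll hq qM1.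
have [t [t0 t1 tp]] := tau_root.
set d := abs (w - z) in hwz *.
have d0 : 0 <= d by apply: abs_ge0.
(* Since [t ^+ p = 1 / p], the first [N = p * m] steps contract by [p^-m]; the last step, in [dM],
   has rate 1. *)
have dN : abs (iter N (f l) w - iter N (f l) z) <= e_ m * d.
  have jN : (N.-1 < N)%N by rewrite ltn_predL.
  have := pair_contract l l w z (abs z) N hl hl wq (lexx _) hwz hll hq qM1 t t0 t1 tp N.-1 jN.
  rewrite prednK // subrr abs0 -/d.
  rewrite (max_idPl _) ?mulr_ge0 ?exprn_ge0 ?(ltW t0) //.
  by rewrite mulrA -exprS prednK // /N exprM tp.
have dM : abs (iter N.+1 (f l) w - iter N.+1 (f l) z) <= e_ m * d.
  have := pair_step l l w z (abs z) N hl hl wq (lexx _) hq N (ltnSn N) (small N (leqnSn N)).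
  rewrite qM mul1r subrr abs0 => /le_trans; apply.
  by rewrite ge_max dN mulr_ge0 // ltW // e_gt0.
set z' := iter N.+1 (f l) z in hM zM dM *; set w' := iter N.+1 (f l) w in dM *.
have d1 : d < 1 by apply: le_lt_trans e2_lt1.
have hM' : abs (w' - h l) <= e_ m.
  rewrite -(subrK z' w') -addrA; apply: abs_leD => //; apply: le_trans dM _.
  by rewrite ler_piMr ?ltW ?e_gt0.
have exz k (km : (k <= m)%N) := expand_orbit l z' m k hl hM km.
have exw k (km : (k <= m)%N) : abs (iter k (f l) w' - iter k (f l) z') <= pR ^+ k * (e_ m * d).
  rewrite (expand_pair l l w' z' m k) // ?subrr ?abs0 //.
  by rewrite ler_wpM2l // exprn_ge0 // ltW // pR_gt0.
(* After [m] expansions by [p] the orbit is back in [abs z < 1], at distance 1 from [h l]; this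
   determines the distance before them. *)
have zh : abs (z' - h l) = e_ m.
  have := exz m (leqnn m); rewrite /z' -iterD -/(elen m) abs_subh //.
  move=> e1; have pm0 : pR ^+ m != 0 by rewrite gt_eqF // exprn_gt0 // pR_gt0.
  by apply: (mulfI pm0); rewrite -e1 pXe // subnn expr0.
split; last exact: zh.
  move=> s sl; have [sN|sN] := leqP s N.
    have /andP[_ z1] := hj s sN.
    rewrite abs_subh // lexx andbT; apply: le_lt_trans e2_lt1.
    by apply: small; apply: leqW.
  have [k [-> km]] : exists k, s = (k + N.+1)%N /\ (k <= m)%N.
    by exists (s - N.+1)%N; rewrite subnK // leq_subLR addnC ltnW.
  rewrite !iterD -/z' -/w' exz // zh.
  have pk0 : 0 < pR ^+ k by rewrite exprn_gt0 // pR_gt0.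
  apply/andP; split; last by rewrite pXe // e_le1.
  apply: le_lt_trans (exw k km) _.
  by rewrite ltr_pM2l // gtr_pMr // e_gt0.
rewrite /elen !iterD -/z' -/w'; apply: le_trans (exw m (leqnn m)) _.
by rewrite mulrA pXe // subnn expr0 mul1r.
Qed.

(** * Successive approximation of the parameter *)

Section Stages.
Variables (x : K -> K) (r0 : R).
Hypothesis r0_lt1 : r0 < 1.
Hypothesis x_poly : poly_approx (fun l => abs (l - 1) <= r0) x.

Local Notation F n l := (iter n (f l) (x l)).

(** Induction hypothesis of the construction. Boundedness up to time [n] makes [F n] approximable by
    polynomials on the ball; the scaling then lets it come close to prescribed values. *)
Definition stage (m n : nat) (c : K) : Prop :=
  [/\ e_ m <= r0, abs (c - 1) <= r0,
      forall l, abs (l - c) <= e_ m -> forall j, (j <= n)%N -> abs (F j l) <= 1 &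
      forall l u, abs (l - c) <= e_ m -> abs (u - c) <= e_ m ->
        abs (F n l - F n u) = pR ^+ m * abs (l - u)].

Lemma poly_approx_sub (D D' : K -> Prop) G :
  (forall l, D' l -> D l) -> poly_approx D G -> poly_approx D' G.
Proof.
move=> DD [[C hC] hG]; split; first by exists C => l /DD /hC.
by move=> e /hG [T hT]; exists T => l /DD /hT.
Qed.

(** By scaling, the values of [F n] at [c] and [c + p^m] are at distance 1, while [F n c] has size
    at most 1, so [poly_approx_root] applies. *)
Lemma stage_root m n c : stage m n c ->
  exists l, abs (l - c) <= e_ m /\ abs (F n l) <= rho.
Proof.
move=> [mr cr hb hs].
have inE l : abs (l - c) <= e_ m -> abs (l - 1) <= r0.
  by move=> hl; apply: (abs_leT _ _ c) => //; apply: le_trans mr.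
have cc : abs (c - c) <= e_ m by rewrite subrr abs0 ltW // e_gt0.
have em : abs (pK ^+ m) = e_ m by rewrite absX absp.
have cl : abs ((c + pK ^+ m) - c) <= e_ m by rewrite addrC addKr em.
have s1 : abs (F n (c + pK ^+ m) - F n c) = 1.
  by rewrite hs // [c + _]addrC addrK em pXe // subnn expr0.
apply: (poly_approx_root (fun l => F n l) c (e_ m) (c + pK ^+ m) c) => //.
- by rewrite s1.
- apply: (poly_approx_iter _ r0 inE).
    exact: poly_approx_sub x_poly.
  by move=> j l jn /hb; apply; apply: ltnW.
- by rewrite s1; apply: hb.
Qed.

(** For a parameter [l1] the orbit is trapped in the ball of radius [rho]; for [l2] it leaves the
    unit ball at time [M]. So [F (M + n) - h] is larger at [l2] than at [l1] and nearly vanishes at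
    some [c']. *)
Lemma stage_return m n c M : stage m n c -> (0 < M)%N ->
  forall e : R, 0 < e -> e < 1 -> exists c',
  [/\ abs (c' - c) <= e_ m, abs (F (M + n) c' - h c') <= e &
      forall j, (j < M)%N -> rho < abs (F (j + n) c') < 1].
Proof.
move=> hst M0 e e0 e1; have [l1 [l1c Fl1]] := stage_root m n c hst.
case: hst => mr cr hb hs.
have inE l : abs (l - c) <= e_ m -> abs (l - 1) <= r0.
  by move=> hl; apply: (abs_leT _ _ c) => //; apply: le_trans mr.
have inL l : abs (l - c) <= e_ m -> abs (l - 1) < 1.
  by move=> /inE hl; apply: le_lt_trans r0_lt1.
have [y [y1 _ hy yM]] := tau_chain M.
have /andP[_ yl1] := hy 0%N M0; rewrite /= in yl1.
have em : abs (pK ^+ m) = e_ m by rewrite absX absp.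
(* On the ball of radius [r] around [l1], [F n] is bounded by [abs y], so no orbit leaves the unit
   ball before time [M]; the bound is attained at [l2]. *)
set r := e_ m * abs y.
have rm : r <= e_ m by rewrite ler_piMr ?ltW ?e_gt0.
have inD l : abs (l - l1) <= r -> abs (l - c) <= e_ m.
  by move=> hl; apply: (abs_leT _ _ l1) => //; apply: le_trans rm.
have l1r : abs (l1 - l1) <= r by rewrite subrr abs0 mulr_ge0 // ltW // e_gt0.
have Fy l : abs (l - l1) <= r -> abs (F n l) <= abs y.
  move=> hl; rewrite -(subrK (F n l1) (F n l)); apply: abs_leD; last first.
    by apply: le_trans (ltW y1).
  rewrite hs ?inD //; apply: le_trans (_ : pR ^+ m * r <= _).
    by rewrite ler_wpM2l // exprn_ge0 // ltW // pR_gt0.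
  by rewrite /r mulrA pXe // subnn mul1r.
have Fj l : abs (l - l1) <= r -> forall j, (j <= M)%N ->
    abs (F (j + n) l) <= iter j tau (abs y).
  move=> hl j jM; rewrite iterD; apply: (orbit_le _ _ _ M) => //.
    by apply: inL; apply: inD.
  exact: Fy.
pose l2 := l1 + pK ^+ m * y.
have l2r : abs (l2 - l1) = r by rewrite /l2 addrC addKr absM em.
have Fl2 : abs (F n l2) = abs y.
  have hd : abs (F n l2 - F n l1) = abs y.
    by rewrite hs ?inD ?l2r ?lexx // /r mulrA pXe // subnn mul1r.
  by rewrite -hd; apply: abs_eqB; rewrite hd opprB addrC subrK; apply: le_lt_trans y1.
have F2M : abs (F (M + n) l2) = iter M tau (abs y).
  rewrite iterD -Fl2; apply: (orbit_eq_tau _ _ M) => //; last by rewrite Fl2.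
  by apply: inL; apply: inD; rewrite l2r.
pose G l := F (M + n) l - h l.
have G1 : abs (G l1) <= 1.
  apply: abs_leB; last by rewrite abs_h ?inL.
  by rewrite iterD ltW // (le_lt_trans _ rho_lt1) // orbit_rho ?inL.
have G2 : abs (G l2) = iter M tau (abs y).
  rewrite /G addrC abs_addl F2M // absN abs_h //.
  by apply: inL; apply: inD; rewrite l2r.
have G12 : abs (G l2 - G l1) = abs (G l2).
  by rewrite addrC abs_addl // absN G2 (le_lt_trans G1).
have GD : poly_approx (fun l => abs (l - l1) <= r) G.
  have inDE l : abs (l - l1) <= r -> abs (l - 1) <= r0 by move=> /inD /inE.
  have hF : poly_approx (fun l => abs (l - l1) <= r) (fun l => F (M + n) l).
    apply: (poly_approx_iter _ r0 inDE).
      exact: poly_approx_sub x_poly.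
    move=> j l jn lr; have [jn'|jn'] := leqP j n.
      by apply: hb => //; apply: inD.
    have [i [ei iM]] : exists i, j = (i + n)%N /\ (i < M)%N.
      by exists (j - n)%N; rewrite (subnK (ltnW jn')) (ltn_subLR _ (ltnW jn')) addnC.
    rewrite ei; apply: le_trans (Fj l lr i (ltnW iM)) _.
    by have /andP[_ /ltW] := hy i iM.
  have hh := poly_approx_h _ r0 inDE r0_lt1.
  apply: poly_approx_ext (poly_approxD _ _ _ hF
     (poly_approxM _ _ _ hh (poly_approx_cst _ (-1)))) => l _.
  by rewrite /G mulrN1.
have [c' [c'r Gc']] : exists c', abs (c' - l1) <= r /\ abs (G c') <= e.
  apply: (poly_approx_root G l1 r l2 l1) => //; rewrite ?l2r ?G12 ?G2 //.
  - exact: lt_trans yM.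
  - exact: le_trans (ltW yM).
have c'L : abs (c' - 1) < 1 by apply: inL; apply: inD.
have FM1 : abs (F (M + n) c') = 1.
  by rewrite -(abs_h c') //; apply: abs_eqB; rewrite abs_h //; apply: le_lt_trans e1.
exists c'; split => //; first exact: inD.
move=> j jM; apply/andP; split.
  (* An orbit entering the ball of radius [rho] would remain there, against [FM1]. *)
  rewrite ltNge; apply/negP => hr.
  have : abs (iter (M - j) (f c') (F (j + n) c')) <= rho by apply: orbit_rho.
  by rewrite -iterD addnA subnK ?(ltnW jM) // FM1 leNgt rho_lt1.
apply: le_lt_trans (Fj c' c'r j (ltnW jM)) _.
by have /andP[] := hy j jM.
Qed.

(** [stage_return] supplies a climb for [c'] of the length required by [excursion]; the parameters
    of the new ball all follow it with the same radii. *)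
Lemma stage_step m n c : stage m n c -> exists c',
  [/\ abs (c' - c) <= e_ m, stage m.+2 (elen m.+2 + n) c' &
      forall l, abs (l - c') <= e_ m.+2 -> excursion l (F n l) m.+2].
Proof.
move=> hst; set N := (p * m.+2)%N.
have mm2 : (m <= m.+2)%N by rewrite -addn2 leq_addr.
have e2m : (m.+2 - m = 2)%N by rewrite -(addn2 m) addKn.
have e_lt1 : e_ m.+2 < 1 by apply: le_lt_trans e2_lt1; apply: e_le.
have [c' [c'c c'h c'j]] := stage_return m n c N.+1 hst (ltn0Sn _) _ (e_gt0 m.+2) e_lt1.
case: hst => mr cr hb hs.
have N0 : (0 < N)%N by rewrite muln_gt0 prime_gt0.
have cin : abs (c' - c') <= e_ m.+2 by rewrite subrr abs0 ltW // e_gt0.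
have lE l : abs (l - c') <= e_ m.+2 -> abs (l - c) <= e_ m.
  by move=> hl; apply: (abs_leT _ _ c') => //; apply: le_trans hl _; apply: e_le.
have inE l : abs (l - c') <= e_ m.+2 -> abs (l - 1) <= r0.
  by move=> /lE hl; apply: (abs_leT _ _ c) => //; apply: le_trans mr.
have inL l : abs (l - c') <= e_ m.+2 -> abs (l - 1) < 1.
  by move=> /inE hl; apply: le_lt_trans r0_lt1.
have c'L := inL c' cin.
have lu2 l u : abs (l - c') <= e_ m.+2 -> abs (u - c') <= e_ m.+2 ->
    abs (l - u) <= e_ m.+2.
  by move=> hl hu; apply: (abs_leT _ _ c') => //; rewrite absB.
(* The increase of [m] by 2 serves here: [p^m * p^-(m+2) = p^-2] is the separation required by the
   estimates for pairs. *)
have dn l u : abs (l - c') <= e_ m.+2 -> abs (u - c') <= e_ m.+2 ->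
    abs (F n l - F n u) <= e_ 2.
  move=> hl hu; rewrite (hs _ _ (lE l hl) (lE u hu)); apply: le_trans (_ : pR ^+ m * e_ m.+2 <= _).
    by apply: ler_wpM2l; [rewrite exprn_ge0 // ltW // pR_gt0 | apply: lu2].
  rewrite pXe //.
  by rewrite e2m.
have lu_e2 l u : abs (l - c') <= e_ m.+2 -> abs (u - c') <= e_ m.+2 ->
    abs (l - u) <= e_ 2.
  by move=> hl hu; apply: le_trans (lu2 l u hl hu) _; apply: e_le.
have hj j : (j < N.+1)%N -> rho < abs (iter j (f c') (F n c')) < 1.
  by move=> /c'j; rewrite iterD.
set q := abs (F n c').
have ctau j (jN : (j <= N.+1)%N) : abs (F (j + n) c') = iter j tau q.
  by rewrite iterD; apply: (orbit_eq c' _ N.+1).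
have hq j : (j < N.+1)%N -> rho < iter j tau q < 1.
  by move=> jN; rewrite -ctau ?c'j // ltnW.
have qM : iter N.+1 tau q = 1.
  by rewrite -ctau //; apply: (abs_near_h c' _ m.+2).
have qM1 : iter N.+1 tau q <= 1 by rewrite qM.
have /andP[q0 _] := hq 0%N (ltn0Sn _).
have lq l : abs (l - c') <= e_ m.+2 -> abs (F n l) <= q.
  move=> hl; rewrite -(subrK (F n c') (F n l)); apply: abs_leD => //.
  apply: le_trans (dn l c' hl cin) _.
  by apply: ltW; apply: lt_trans e2_lt_rho q0.
have lmod l j : abs (l - c') <= e_ m.+2 -> (j < N.+1)%N ->
    abs (F (j + n) l) = iter j tau q.
  move=> hl jN; rewrite -ctau ?(ltnW jN) //; apply: abs_eqB.
  have := pair_small l c' (F n l) (F n c') q N (inL l hl) c'L (lq l hl) (lq c' cin)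
    (dn l c' hl cin) (lu_e2 l c' hl cin) hq qM1 j (ltnW jN).
  rewrite -!iterD => /le_lt_trans; apply; apply: lt_trans e2_lt_rho _.
  by rewrite ctau ?(ltnW jN) //; have /andP[] := hq j jN.
(* Before the exit step the separation is at most the larger of [p^-2 * abs (l - u)], inherited from
   [F n], and [t * abs (l - u)], due to the parameter; both are too small to disturb [pair_exit]. *)
have exitd l u : abs (l - c') <= e_ m.+2 -> abs (u - c') <= e_ m.+2 ->
    abs (F (N.+1 + n) l - F (N.+1 + n) u) = abs (l - u).
  move=> hl hu; have [->|lu] := eqVneq l u; first by rewrite !subrr.
  have d0 : 0 < abs (l - u) by rewrite abs_gt0 subr_eq0.
  rewrite ![iter (N.+1 + n) _ _]iterD.
  apply: (pair_exit l u (F n l) (F n u) q N) => //.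
  - exact: inL.
  - exact: inL.
  - exact: lq.
  - exact: lq.
  - exact: dn.
  - exact: lu_e2.
  - by rewrite -iterD lmod.
  have [t [t0 t1 tp]] := tau_root.
  have jN : (N.-1 < N)%N by rewrite ltn_predL.
  have := pair_contract l u (F n l) (F n u) q N (inL l hl) (inL u hu)
    (lq l hl) (lq u hu) (dn l u hl hu) (lu_e2 l u hl hu) hq qM1 t t0 t1 tp N.-1 jN.
  rewrite prednK // => /le_lt_trans; apply.
  rewrite maxr_pMr ?(ltW t0) // gt_max gtr_pMl // t1 andbT.
  rewrite mulrA -exprS prednK // /N exprM tp (hs _ _ (lE l hl) (lE u hu)).
  rewrite mulrA [X in X * _]mulrC pXe //.
  by rewrite gtr_pMl // e2m e2_lt1.
(* Closeness to [h] passes from [c'] to the new ball, by [exitd] and [h_lip]. *)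
have near l : abs (l - c') <= e_ m.+2 -> abs (F (N.+1 + n) l - h l) <= e_ m.+2.
  move=> hl; apply: (abs_leT _ _ (F (N.+1 + n) c')).
    by rewrite exitd // lu2.
  apply: (abs_leT _ _ (h c')) => //.
  by apply: le_trans (h_lip c' l c'L (inL l hl)) _; rewrite absB.
have exc l : abs (l - c') <= e_ m.+2 -> excursion l (F n l) m.+2.
  move=> hl; split; last by rewrite -iterD; apply: near.
  by move=> j jN; rewrite -iterD lmod ?hq.
exists c'; split=> //; split.
- by apply: le_trans mr; apply: e_le.
- exact: inE.
- move=> l hl j jn; have [jn'|nj] := leqP j n; first by apply: hb => //; apply: lE.
  have [jM|Mj] := ltnP j (N.+1 + n).
    have {1}-> : j = ((j - n) + n)%N by rewrite subnK // ltnW.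
    have jN : (j - n < N.+1)%N by rewrite (ltn_subLR _ (ltnW nj)) addnC.
    by rewrite lmod //; have /andP[_ /ltW] := hq _ jN.
  have [k [ek km]] : exists k, j = (k + (N.+1 + n))%N /\ (k <= m.+2)%N.
    exists (j - (N.+1 + n))%N; rewrite (subnK Mj) leq_subLR.
    by split => //; rewrite addnC addnA.
  rewrite ek iterD; set z := F (N.+1 + n) l.
  have hz : abs (z - h l) <= e_ m.+2 by apply: near.
  rewrite -(subrK (h l) (iter _ _ _)); apply: abs_leD; last by rewrite abs_h ?inL.
  rewrite (expand_orbit l z m.+2 k) ?inL //.
  apply: le_trans (_ : pR ^+ k * e_ m.+2 <= _).
    by rewrite ler_wpM2l // exprn_ge0 // ltW // pR_gt0.
  by rewrite pXe // e_le1.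
move=> l u hl hu; rewrite /elen -/N -!addnA !(iterD m.+2).
by rewrite (expand_pair l u _ _ m.+2 m.+2) ?inL ?near ?exitd.
Qed.

(** Time and centre at stage [i], whose exponent is [m0 + i.*2]; [next] chooses the new centre. *)
Fixpoint stages (next : nat -> nat -> K -> K) (m0 : nat) (c0 : K) (i : nat) :
    nat * K :=
  if i is j.+1 then
    let: (n, c) := stages next m0 c0 j in
    ((elen (m0 + j.*2).+2 + n)%N, next (m0 + j.*2)%N n c)
  else (0%N, c0).

Lemma stages_exist m0 c0 : stage m0 0 c0 ->
  exists (n : nat -> nat) (c : nat -> K),
  [/\ n 0%N = 0%N, c 0%N = c0,
      forall i, n i.+1 = (elen (m0 + i.*2).+2 + n i)%N,
      forall i, abs (c i.+1 - c i) <= e_ (m0 + i.*2) &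
      forall i l, abs (l - c i.+1) <= e_ (m0 + i.*2).+2 ->
        excursion l (F (n i) l) (m0 + i.*2).+2].
Proof.
move=> st0.
pose P m n c c' := [/\ abs (c' - c) <= e_ m, stage m.+2 (elen m.+2 + n) c' &
  forall l, abs (l - c') <= e_ m.+2 -> excursion l (F n l) m.+2].
pose next m n c : K := epsilon (inhabits 0) (P m n c).
have nextP m n c : stage m n c -> P m n c (next m n c).
  by move=> /stage_step hP; apply: epsilon_spec.
pose s := stages next m0 c0.
have sS i : s i.+1 = ((elen (m0 + i.*2).+2 + (s i).1)%N, next (m0 + i.*2)%N (s i).1 (s i).2).
  by rewrite /s /=; case: (stages _ _ _ i).
have st i : stage (m0 + i.*2) (s i).1 (s i).2.
  elim: i => [|i IH]; first by rewrite addn0.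
  by have [_ hst _] := nextP _ _ _ IH; rewrite sS /= doubleS !addnS.
exists (fun i => (s i).1), (fun i => (s i).2); split => //.
- by move=> i; rewrite sS.
- by move=> i; rewrite sS; have [] := nextP _ _ _ (st i).
- by move=> i l; rewrite sS; have [_ _] := nextP _ _ _ (st i); apply.
Qed.

End Stages.

(** [l] is the limit of the centres of successive stages and lies in all their balls, so the orbit
    of [x l] makes every excursion. *)
Lemma wandering_parameter l0 (e : R) : abs (l0 - 1) < 1 -> 0 < e ->
  exists (l z0 : K) (E : nat -> R),
  [/\ abs (l0 - l) < e /\ abs (l - 1) < 1,
      forall w, abs (w - z0) <= e_ 2 -> forall t, abs (iter t (f l) w - h l) = E t,
      forall t, 0 < E t <= 1,
      forall (d : R) N, 0 < d -> exists2 t, (N <= t)%N & E t < d &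
      forall N, exists2 t, (N <= t)%N & E t = 1].
Proof.
move=> hl0 e0.
have [k0 hk0] := invp_small e e0.
pose k := k0.+1.
have ek : e_ k < e by apply: hk0; rewrite leqnSn.
have ek1 : e_ k < 1 by rewrite exprn_ilt1 ?ltW ?invp_gt0 ?invp_lt1.
pose r0 := Num.max (abs (l0 - 1)) (e_ k).
have r01 : r0 < 1 by rewrite gt_max hl0.
(* Division by [p^k] makes [x] itself a stage of exponent [k] at time 0 around [l0]. *)
pose x l := (l - l0) * (pK ^+ k)^-1.
have absk y : abs (y * (pK ^+ k)^-1) = pR ^+ k * abs y.
  by rewrite absM absV absX absp exprVn invrK mulrC.
have x_poly : poly_approx (fun l => abs (l - 1) <= r0) x.
  apply: poly_approxM (poly_approx_cst _ _).
  apply: poly_approxD (poly_approx_cst _ _).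
  exact: (poly_approx_id _ 1 r0).
have st : stage x r0 k 0 l0.
  split; rewrite ?le_max ?lexx ?orbT //.
    move=> l hl j; rewrite leqn0 => /eqP -> /=; rewrite absk.
    apply: le_trans (_ : pR ^+ k * e_ k <= _).
      by rewrite ler_wpM2l // exprn_ge0 // ltW // pR_gt0.
    by rewrite pXe // e_le1.
  by move=> l u _ _; rewrite /= -mulrBl opprB addrA subrK absk.
have [n [c [n0 c0 nS cS hexc]]] := stages_exist x r0 r01 x_poly k l0 st.
have tail i j : abs (c (i + j)%N - c i) <= e_ (k + i.*2).
  elim: j => [|j IH]; first by rewrite addn0 subrr abs0 ltW // e_gt0.
  rewrite addnS; apply: (abs_leT _ _ (c (i + j)%N)) => //.
  by apply: le_trans (cS _) _; apply: e_le; rewrite leq_add2l leq_double leq_addr.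
have [l hl] : exists l, kconv abs c l.
  apply: Kcomplete => d /invp_small [N hN]; exists N => i j hi hj.
  have hN' : e_ (k + N.*2) < d by apply: hN; rewrite -addnn addnA leq_addl.
  apply: le_lt_trans hN'; apply: (abs_leT _ _ (c N)).
    by rewrite -(subnKC hi).
  by rewrite absB -(subnKC hj).
have lc i : abs (l - c i) <= e_ (k + i.*2).
  apply: (kconv_cst_le c) => //; first by rewrite ltW // e_gt0.
  by exists i => j ij; rewrite -(subnKC ij).
have l0l : abs (l0 - l) <= e_ k.
  by rewrite absB; have := lc 0%N; rewrite c0 addn0.
have l1 : abs (l - 1) < 1.
  apply: le_lt_trans r01; apply: (abs_leT _ _ l0); last by rewrite le_max lexx.
  by rewrite absB le_max l0l orbT.
pose y i := iter (n i) (f l) (x l).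
have exc i : excursion l (y i) (k + i.*2).+2.
  by apply: hexc; have := lc i.+1; rewrite doubleS !addnS.
have y1 i : abs (y i) < 1 by have [/(_ 0%N isT) /andP[]] := exc i.
have yS i : iter (elen (k + i.*2).+2) (f l) (y i) = y i.+1.
  by rewrite /y nS iterD.
pose E t := abs (iter t (f l) (x l) - h l).
have nlt i : (n i < n i.+1)%N by rewrite nS /elen addSn addSn ltnS -addSn leq_addl.
have nge i : (i <= n i)%N by elim: i => // i IH; apply: leq_ltn_trans (nlt i).
(* [excursion_disc] is applied repeatedly: the disc is no larger at the end of an excursion than at
   its start, so the next one can be treated alike. *)
have disc w : abs (w - x l) <= e_ 2 -> forall i,
    abs (iter (n i) (f l) w - y i) <= e_ 2 /\
    forall t, (t < n i)%N -> abs (iter t (f l) w - iter t (f l) (x l)) < E t <= 1.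
  move=> hw; elim=> [|i [IH1 IH2]]; first by rewrite /y n0.
  have := excursion_disc l (y i) _ (k + i.*2).+2 l1 (ltn0Sn _) (exc i) _ IH1.
  rewrite yS y1 => /(_ isT) [h1 h2 _]; split.
    by move: h2; rewrite -iterD -nS => /le_trans; apply.
  move=> t tn; have [/IH2 //|nt] := ltnP t (n i).
  have := h1 (t - n i)%N; rewrite /y -!iterD (subnK nt); apply.
  by rewrite (ltn_subLR _ nt) addnC -nS.
have disc' w : abs (w - x l) <= e_ 2 -> forall t,
    abs (iter t (f l) w - iter t (f l) (x l)) < E t <= 1.
  move=> hw t; have [_ ht] := disc w hw t.+1; apply: ht; exact: nge.
have xx : abs (x l - x l) <= e_ 2 by rewrite subrr abs0 ltW // e_gt0.
exists l, (x l), E; split => //.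
- by split => //; apply: le_lt_trans ek.
- move=> w hw t; have /andP[h1 _] := disc' w hw t.
  by rewrite -(subrK (iter t (f l) (x l)) (iter t _ w)) -addrA abs_addl.
- by move=> t; have := disc' (x l) xx t; rewrite subrr abs0.
- move=> d N /invp_small [N2 hN2]; pose i := maxn N N2.
  have yy : abs (y i - y i) <= e_ 2 by rewrite subrr abs0 ltW // e_gt0.
  have yi : abs (iter (elen (k + i.*2).+2) (f l) (y i)) < 1 by rewrite yS y1.
  have [_ _ hE] := excursion_disc l (y i) (y i) _ l1 (ltn0Sn _) (exc i) yi yy.
  (* The end of the [i]-th climb, at distance exactly [p^-(k+2i+2)] from [h l]. *)
  exists ((p * (k + i.*2).+2).+1 + n i)%N.
    by apply: leq_trans (leq_addl _ _); apply: leq_trans (nge i); rewrite leq_maxl.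
  rewrite /E iterD hE; apply: hN2; apply: leq_trans (leq_maxr N N2) _.
  by rewrite -/i -addnn -!addnS addnCA leq_addr.
(* Excursions start at the times [n N], where the orbit lies in [abs z < 1]. *)
move=> N; exists (n N); first exact: nge.
by rewrite /E abs_subh // y1.
Qed.


End WanderingDiscs.

Theorem theorem3p3 (R : realType) (K : fieldType) (abs : K -> R) (p : nat)
  (rho rhat : R) (a : nat -> K) :
  prime p -> is_Cp p abs ->
  0 < rho -> rho ^+ p.-1 = (p%:R)^-1 ->
  1 < rhat -> (exists w : K, w != 0 /\ abs w = rhat) ->
  in_HB abs rhat a ->
  (exists c : R, c < rho /\ forall i, abs (a i) * rhat ^+ i <= c) ->
  exists L : K -> Prop,
    [/\ (forall l, L l -> abs (l - 1) < 1),
        (forall l, abs (l - 1) < 1 -> forall e : R, 0 < e ->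
           exists l', L l' /\ abs (l - l') < e) &
        (forall l, L l ->
           exists (c : K) (s : R),
             [/\ 0 < s,
                 forall z, cball abs c s z -> in_filled abs rhat (Qmap p abs a l) z,
                 wandering (Qmap p abs a l) (cball abs c s) &
                 not_attracted abs rhat (Qmap p abs a l) (cball abs c s)])].
Proof.
move=> p_pr [abs_ge0 [abs_eq0 [absM [absD [absp [_ [Kcomplete [Kclosed _]]]]]]]].
move=> rho_gt0 rho_p rhat_gt1 _ a_HB [kap [kap_rho a_le]].
pose Q := ps_eval abs a; pose h := hfix p abs a.
have Q_le z : abs z <= 1 -> abs (Q z) <= kap.
  by apply: ps_eval_le; eassumption.
have Q_lip z w : abs z <= 1 -> abs w <= 1 -> abs (Q z - Q w) <= kap * abs (z - w).
  by apply: ps_eval_lip; eassumption.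
have Q_poly (e : R) : 0 < e -> exists T : {poly K},
    forall z, abs z <= 1 -> abs (Q z - T.[z]) <= e.
  by apply: ps_eval_poly; eassumption.
have kap_ge0 : 0 <= kap by apply: bound_ge0; eassumption.
have h_fix l : abs (l - 1) < 1 ->
    abs (h l - 1) <= q1 R K abs p Q /\ f K p Q l (h l) = h l.
  move=> hl; apply: (epsilon_spec (inhabits 0)
    (fun z => abs (z - 1) <= abs (ps_eval abs a 1) / p%:R /\ Qstar p abs a l z = z)).
  by apply: fixed_point_exists; eassumption.
have iterQ l n z :
    iter n (Qmap p abs a l) z = iter n (f K p Q l) (z + h l - 1) + 1 - h l.
  elim: n => [|n IH] /=; first by ring.
  rewrite IH /Qmap -/(h l) /Qstar /f -/Q.
  by have -> (y : K) : y + 1 - h l + h l - 1 = y by ring.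
pose good l := exists (c : K) (s : R),
  [/\ 0 < s,
      forall z, cball abs c s z -> in_filled abs rhat (Qmap p abs a l) z,
      wandering (Qmap p abs a l) (cball abs c s) &
      not_attracted abs rhat (Qmap p abs a l) (cball abs c s)].
(* All parameters admitting a suitable disc are taken, so that only density remains. *)
exists (fun l => abs (l - 1) < 1 /\ good l).
split=> [l [] //| l0 hl0 e e0 | l [] //].
have [l [z0 [E [[l0l l1] hE E_bound E_small E_one]]]] :=
  wandering_parameter R K abs abs_ge0 abs_eq0 absM absD Kclosed Kcomplete p rho
    kap Q p_pr absp rho_gt0 rho_p kap_ge0 kap_rho Q_le Q_lip Q_poly h h_fix
    l0 e hl0 e0.
exists l; split=> //; split=> //.
(* The centre is the preimage of [z0] under the translation by [h l - 1], which takes 1 to [h l]. *)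
have hE' w : abs (w - (z0 + 1 - h l)) <= p%:R^-1 ^+ 2 ->
    forall t, abs (iter t (Qmap p abs a l) w - 1) = E t.
  move=> hw t; rewrite iterQ -(hE (w + h l - 1)).
    by congr abs; ring.
  by have -> : w + h l - 1 - z0 = w - (z0 + 1 - h l) by ring.
have g1 : Qmap p abs a l 1 = 1.
  have [_ hf] := h_fix l l1; have := iterQ l 1%N 1; rewrite /= => ->.
  rewrite [1 + h l]addrC addrK hf; ring.
exists (z0 + 1 - h l), (p%:R^-1 ^+ 2); split.
- by rewrite exprn_gt0 // invr_gt0 ltr0n prime_gt0.
(* Iterates stay within distance 1 of 1, hence in the unit ball, which lies in [B]. *)
- move=> z hz n; have /andP[_ E1] := E_bound n.
  rewrite /inB -(subrK 1 (iter n _ z)); apply: le_trans (absD _ _) _.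
  have -> : abs 1 = 1 by apply: abs1; eassumption.
  rewrite ge_max hE' // (ltW rhat_gt1) andbT.
  exact: le_trans E1 (ltW rhat_gt1).
- by apply: itinerary_wandering; eassumption.
- by apply: itinerary_not_attracted; eassumption.
Qed.
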